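(* Let $G$ be a generalized amenable extension of $U$, with free $G$-$U$-space $X$ and exhaustion $X_1\subset X_2\subset\cdots\subset X$ as in the definition of generalized amenable extension, and let $N_i=|X_i/U|$. Let $B\in M(d\times d,\mathbb{C}G)$ and $B[i]=P_iB_XP_i^*\colon l^2(X_i)^d\to l^2(X_i)^d$. Then $$\dim_G(\ker(B))=\lim_{i\to\infty}\frac{\dim_U(\ker(B[i]))}{N_i}.$$
   Context: For a discrete group $G$, $l^2(G)=\{f\colon G\to\mathbb{C}\mid \sum_{g\in G}|f(g)|^2<\infty\}$. A matrix $A\in M(d\times d,\mathbb{C}G)$ acts by left convolution as a bounded operator $A\colon l^2(G)^d\to l^2(G)^d$, which commutes with the right $G$-action. For a bounded operator $T$ on $l^2(G)^n$ commuting with the right $G$-action put $\mathrm{tr}_G(T)=\sum_{i=1}^n\langle Te_i,e_i\rangle$, where $e_i\in l^2(G)^n$ has the trivial element $1\in G\subset l^2(G)$ in the $i$-th position and zeros elsewhere; the $\dim_G$ of the kernel of such an operator is $\mathrm{tr}_G$ of the orthogonal projection onto it. Generalized amenable extension: let $G$ be a finitely generated discrete group with a finite symmetric set of generators $S$, and let $U$ be a normal subgroup of $G$. $G$ is a generalized amenable extension of $U$ if there is a set $X$ with a free left $G$-action and a commuting free right $U$-action, and a sequence of $U$-invariant subsets $X_1\subset X_2\subset\cdots\subset X$ with $\bigcup_k X_k=X$, $|X_k/U|<\infty$ for every $k$, and $\frac{|(S\cdot X_k-X_k)/U|}{|X_k/U|}\to 0$ as $k\to\infty$ (here $S\cdot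 X_k-X_k$ is the set difference). $B_X$ is the operator on $l^2(X)^d$ induced by $B$ through the free left $G$-action: if $B=(b_{kl})$ with $b_{kl}=\sum_g\lambda^g_{kl}g$, then $B_X$ is the matrix of operators $\sum_g\lambda^g_{kl}L_g$, where $L_g\delta_x=\delta_{gx}$ on $l^2(X)$. It commutes with the right $U$-action. $P_i\colon l^2(X)^d\to l^2(X_i)^d$ is the orthogonal projection (restriction to $X_i$) and $P_i^*$ is the inclusion. Choosing representatives of the $N_i$ free $U$-orbits in $X_i$ identifies $l^2(X_i)^d$ with $l^2(U)^{N_id}$ compatibly with the right $U$-action, and $\mathrm{tr}_U$, $\dim_U$ are defined via this identification (independently of the choice). *)

(* Defs.v *)
From HB Require Import structures.
From mathcomp Require Import all_boot all_algebra finmap.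
From mathcomp Require Import all_classical all_reals all_analysis.
From mathcomp Require Import complex.

Set Implicit Arguments.
Unset Strict Implicit.
Unset Printing Implicit Defensive.

Import GRing.Theory Num.Theory.
Import numFieldNormedType.Exports.

Local Open Scope classical_set_scope.
Local Open Scope ring_scope.

(* Vectors of l^2(T)^I are represented as functions I -> T -> R[i] satisfying
   the predicate l2. *)

Section Hilbert.
Variables (R : realType) (T : choiceType).

Definition square_summable (f : T -> R[i]) : Prop :=
  (\esum_(x in [set: T]) (Normc.normc (f x) ^+ 2)%:E < +oo)%E.

(* Unordered sums over T of absolutely summable families; junk if the family
   is not absolutely summable, which does not happen in inner products of l^2
   vectors. *)
Definition rsum (f : T -> R) : R :=
  fine (\esum_(x in [set: T]) (f^\+ x)%:E) -
  fine (\esum_(x in [set: T]) (f^\- x)%:E).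

Definition csum (f : T -> R[i]) : R[i] :=
  Complex (rsum (fun x => complex.Re (f x))) (rsum (fun x => complex.Im (f x))).

Variable I : finType.

Definition l2 : set (I -> T -> R[i]) :=
  [set f | forall i, square_summable (f i)].

Definition inner (f h : I -> T -> R[i]) : R[i] :=
  \sum_i csum (fun x => f i x * conjc (h i x)).

Definition l2ker (A : (I -> T -> R[i]) -> (I -> T -> R[i])) :
  set (I -> T -> R[i]) := [set f | l2 f /\ A f = 0].

(* Orthogonal projection onto K; total function, meaningful when K is a closed
   subspace of l^2(T)^I and f is in l^2(T)^I (the point is then unique). *)
Definition orth_proj (K : set (I -> T -> R[i])) (f : I -> T -> R[i]) :
    I -> T -> R[i] :=
  xget 0 [set h | K h /\ forall k, K k -> inner (f - h) k = 0].

End Hilbert.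

Section VonNeumannDimension.
Variables (R : realType) (H : groupType) (I : finType).

Definition unit_vec (i : I) : I -> H -> R[i] :=
  fun j x => ((j == i) && (x == 1%g))%:R.

Definition vn_trace (A : (I -> H -> R[i]) -> (I -> H -> R[i])) : R[i] :=
  \sum_i inner (A (unit_vec i)) (unit_vec i).

(* The trace of an orthogonal projection p is the sum of the <p e_i, p e_i>,
   hence real: taking the real part only changes the type. *)
Definition vn_dim (K : set (I -> H -> R[i])) : R :=
  complex.Re (vn_trace (orth_proj K)).

End VonNeumannDimension.

Definition left_action (H : groupType) (X : Type) (act : H -> X -> X) : Prop :=
  (forall x, act 1%g x = x) /\
  (forall g h x, act (g * h)%g x = act g (act h x)).

Definition right_action (H : groupType) (X : Type) (act : X -> H -> X) : Prop :=
  (forall x, act x 1%g = x) /\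
  (forall x u v, act x (u * v)%g = act (act x u) v).

Section Orbits.
Variables (U : groupType) (X : choiceType) (ract : X -> U -> X).

(* A / U, as a set of U-orbits *)
Definition orbits (A : set X) : set (set X) := [set range (ract x) | x in A].

(* | A / U |, meaningful when A / U is finite *)
Definition norbits (A : set X) : nat := #|` fset_set (orbits A)|.

Definition orbit_representatives (A : set X) (N : nat) (r : 'I_N -> X) : Prop :=
  [/\ forall a, A (r a),
      forall a b, range (ract (r a)) = range (ract (r b)) -> a = b &
      forall x, A x -> exists a u, x = ract (r a) u].

End Orbits.

Definition generates (G : groupType) (S : set G) : Prop :=
  forall g, exists s : seq G,
    (forall h, h \in s -> S h) /\ g = (\prod_(h <- s) h)%g.

(* space_nonempty is implicit in the quotients of exhaustion_foelner being
   defined: it gives |X_k / U| <> 0 for large k. Without it, since 0 / 0 = 0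
   here, X = set0 would qualify. *)
Record gen_amenable_extension (R : realType) (G U : groupType) (S : set G)
    (X : choiceType) (lact : G -> X -> X) (ract : X -> U -> X)
    (Xs : nat -> set X) : Prop := {
  gens_finite : finite_set S;
  gens_symmetric : forall s, S s -> S (s^-1)%g;
  gens_generate : generates S;
  lact_action : left_action lact;
  lact_free : forall g x, lact g x = x -> g = 1%g;
  ract_action : right_action ract;
  ract_free : forall x u, ract x u = x -> u = 1%g;
  actions_commute : forall g x u, lact g (ract x u) = ract (lact g x) u;
  space_nonempty : [set: X] !=set0;
  exhaustion_invariant : forall k x u, Xs k x -> Xs k (ract x u);
  exhaustion_increasing : forall k, Xs k `<=` Xs k.+1;
  exhaustion_covers : \bigcup_k Xs k = [set: X];
  exhaustion_finite : forall k, finite_set (orbits ract (Xs k));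
  exhaustion_foelner :
    (norbits ract ([set lact s x | s in S & x in Xs k] `\` Xs k))%:R
      / (norbits ract (Xs k))%:R @[k --> \oo] --> (0 : R)
}.

(* CG: finitely supported functions G -> C. Only the C-linear structure of the
   group ring plays a role in what follows. *)
Notation group_ring R G := {fsfun G -> R[i] with 0}.

Section Operators.
Variables (R : realType) (G : groupType) (d : nat).
Variable B : 'M[group_ring R G]_d.

(* The matrix of operators \sum_g lambda^g_kl L_g, where L_g delta_x is
   delta_(g x), i.e. (L_g f) x = f (g^-1 x). *)
Definition mx_operator (X : Type) (lact : G -> X -> X)
    (f : 'I_d -> X -> R[i]) : 'I_d -> X -> R[i] :=
  fun k x => \sum_l \sum_(g <- finsupp (B k l)) B k l g * f l (lact (g^-1)%g x).

Definition conv_operator : ('I_d -> G -> R[i]) -> ('I_d -> G -> R[i]) :=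
  mx_operator (fun g x => (g * x)%g).

Variables (X : choiceType) (lact : G -> X -> X).

Definition restriction (A : set X) (f : 'I_d -> X -> R[i]) :
  'I_d -> A -> R[i] := fun k => sigL A (f k).

Definition inclusion (A : set X) (f : 'I_d -> A -> R[i]) :
  'I_d -> X -> R[i] := fun k => 'valL_0 (f k).

Definition compression (A : set X) (f : 'I_d -> A -> R[i]) :
  'I_d -> A -> R[i] := restriction (A := A) (mx_operator lact (inclusion f)).

End Operators.

(* The identification of l^2(A)^d with l^2(U)^(N d) given by representatives
   r of the U-orbits in A; the N d coordinates are indexed by 'I_N * 'I_d. *)
Definition orbit_coordinates (R : realType) (U : groupType) (X : choiceType)
    (ract : X -> U -> X) (A : set X) (N d : nat) (r : 'I_N -> X)
    (f : 'I_d -> A -> R[i]) : 'I_N * 'I_d -> U -> R[i] :=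
  fun p u => inclusion f p.2 (ract (r p.1) u).

(* dim_U of a subspace of l^2(A)^d *)
Definition vn_dim_orbits (R : realType) (U : groupType) (X : choiceType)
    (ract : X -> U -> X) (A : set X) (N d : nat) (r : 'I_N -> X)
    (K : set ('I_d -> A -> R[i])) : R :=
  vn_dim (orbit_coordinates ract r @` K).

(* Main.v *)
Require Import Defs.
From HB Require Import structures.
From mathcomp Require Import all_boot all_order all_algebra finmap.
From mathcomp Require Import all_classical all_reals all_analysis.
From mathcomp Require Import complex.
From mathcomp Require Import ring lra.

(** Let [D] be the dimension of the kernel of [B] on [l^2(G)^d], let [K] be the
    kernel of [B_X] on [l^2(X)^d], and let [A] be one of the sets [X_i], with
    [N] orbits. Since [G] acts freely, [l^2(X)] is the direct sum over the
    [G]-orbits of copies of [l^2(G)], on which [B_X] acts as [B]. The diagonal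
    coefficients of the projection onto [K] are therefore the same at all
    points of [X] as over [G] ([proj_orbit]), and its trace over the orbits of
    [A] is [N * D]. It remains to compare [K] with the kernel of the
    compression [B[i]] to [A]; they differ only near the boundary of [A].

    - A vector killed by [B[i]] that vanishes at all points of [A] which some
      element of the support of [B] moves out of [A] is killed by [B_X].
      Hence [dim (ker B[i]) <= N * D + O(boundary)]
      ([real_dim_compressed_le]).
    - The restriction to [A] of a vector of [K] is killed by [B[i]] except at
      the points which the inverse of some element of the support moves out
      of [A]. The closure of these restrictions has dimension at least
      [N * D], whence [N * D <= dim (ker B[i]) + O(boundary)]
      ([real_dim_compressed_ge]).

    Both steps rest on one inequality ([real_dim_kernel]): [m] equivariant
    linear conditions lower the dimension by at most [m]. In finite dimension
    this is the rank theorem. Here it follows from the trace property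
    ([trace_ip]). If [T] is an equivariant contraction, the powers of
    [1 - T^* T] converge to the projection onto [ker T], and the trace of
    [1 - (1 - T^* T)^n] equals that of [1 - (1 - T T^* )^n], which is at most
    the number of basis vectors not killed by [T^*] ([rank_bound]). Only
    powers of operators occur, and the complex coefficients of [B] are
    arbitrary.

    Finally the boundary is small: along a word in the generators a point that
    leaves [A] crosses [S A - A] at some step, so the number of boundary
    orbits is at most a constant times [|(S A - A) / U|]
    ([word_exit_count]), which is [o(N)] by the Foelner condition.

    The Hilbert space theory is developed over the reals, a complex vector
    being the family of its real and imaginary parts. The real orthogonal
    projection onto a complex subspace is the complex one, and the real
    dimension is twice the complex dimension ([vn_dimE]). *)

Set Implicit Arguments.
Unset Strict Implicit.
Unset Printing Implicit Defensive.

Import Order.TTheory GRing.Theory Num.Theory.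
Import numFieldNormedType.Exports.

Local Open Scope classical_set_scope.
Local Open Scope ring_scope.

(** * Sums of nonnegative and of absolutely summable families *)

Section Esum.
Variables (R : realType) (Z : choiceType).
Implicit Types (a b : Z -> R).

Lemma esum_le_finite (a : Z -> R) (M : R) :
  (forall s : seq Z, uniq s -> \sum_(z <- s) a z <= M) ->
  (\esum_(z in [set: Z]) (a z)%:E <= M%:E)%E.
Proof.
move=> H; apply: ge_ereal_sup => _ [X [finX _]] <-.
rewrite fsbig_finite //= sumEFin lee_fin; apply: H; exact: fset_uniq.
Qed.

Lemma sum_le_esum (a : Z -> R) (s : seq Z) : (forall z, 0 <= a z) -> uniq s ->
  ((\sum_(z <- s) a z)%:E <= \esum_(z in [set: Z]) (a z)%:E)%E.
Proof.
move=> a0 us; apply: esum_ge; exists [set` s].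
  by split=> [|z _]; [exact: finite_seq|].
by rewrite -fsbig_seq //= sumEFin.
Qed.

Definition tsum a : R := fine (\esum_(z in [set: Z]) (a z)%:E).
Definition finite_sum a : Prop := (\esum_(z in [set: Z]) (a z)%:E < +oo)%E.

Lemma tsumE a : (forall z, 0 <= a z) -> finite_sum a ->
  \esum_(z in [set: Z]) (a z)%:E = (tsum a)%:E.
Proof.
move=> a0 fa; rewrite /tsum fineK // ge0_fin_numE //.
by apply: esum_ge0 => z _; rewrite lee_fin.
Qed.

Lemma finite_sum_le a b : (forall z, a z <= b z) -> finite_sum b -> finite_sum a.
Proof.
move=> ab; apply: le_lt_trans; apply: le_esum => z _; by rewrite lee_fin.
Qed.

Lemma finite_sumD a b : (forall z, 0 <= a z) -> (forall z, 0 <= b z) ->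
  finite_sum a -> finite_sum b -> finite_sum (fun z => a z + b z).
Proof.
move=> a0 b0 fa fb; rewrite /finite_sum.
under eq_esum do rewrite EFinD.
by rewrite esumD ?lte_add_pinfty // => z _; rewrite lee_fin.
Qed.

Lemma tsumD a b : (forall z, 0 <= a z) -> (forall z, 0 <= b z) ->
  finite_sum a -> finite_sum b -> tsum (fun z => a z + b z) = tsum a + tsum b.
Proof.
move=> a0 b0 fa fb; apply: EFin_inj; rewrite EFinD.
rewrite -!tsumE //; last 2 first.
- by move=> z; rewrite addr_ge0.
- exact: finite_sumD.
under eq_esum do rewrite EFinD.
by rewrite esumD // => z _; rewrite lee_fin.
Qed.

Lemma tsum_ge0 a : (forall z, 0 <= a z) -> 0 <= tsum a.
Proof. by move=> a0; apply/fine_ge0/esum_ge0 => z _; rewrite lee_fin. Qed.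

Lemma sum_le_tsum a (s : seq Z) : (forall z, 0 <= a z) -> finite_sum a -> uniq s ->
  \sum_(z <- s) a z <= tsum a.
Proof.
by move=> a0 fa us; rewrite -lee_fin -tsumE //; exact: sum_le_esum.
Qed.

Lemma finite_sumP a M : (forall z, 0 <= a z) ->
  (forall s : seq Z, uniq s -> \sum_(z <- s) a z <= M) ->
  finite_sum a /\ tsum a <= M.
Proof.
move=> a0 H; have fa : finite_sum a.
  exact: le_lt_trans (esum_le_finite H) (ltry _).
by split=> //; rewrite -lee_fin -tsumE //; exact: esum_le_finite.
Qed.

Lemma tsumZ c a : 0 <= c -> (forall z, 0 <= a z) -> finite_sum a ->
  finite_sum (fun z => c * a z) /\ tsum (fun z => c * a z) = c * tsum a.
Proof.
have le c' a' : 0 <= c' -> (forall z, 0 <= a' z) -> finite_sum a' ->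
    finite_sum (fun z => c' * a' z) /\ tsum (fun z => c' * a' z) <= c' * tsum a'.
  move=> c0 a0 fa; apply: finite_sumP; first by move=> z; rewrite mulr_ge0.
  by move=> s us; rewrite -mulr_sumr ler_wpM2l // sum_le_tsum.
move=> c0 a0 fa; have [fc tc] := le c a c0 a0 fa; split=> //.
move: c0; rewrite le_eqVlt => /orP[/eqP <-|c0].
  rewrite mul0r /tsum esum1 // => z _; by rewrite mul0r.
apply/eqP; rewrite eq_le tc /=.
have [] := le c^-1 (fun z => c * a z) _ _ fc.
- by rewrite invr_ge0 ltW.
- by move=> z; rewrite mulr_ge0 // ltW.
move=> _; have -> : (fun z => c^-1 * (c * a z)) = a.
  by apply/funext => z; rewrite mulKf // gt_eqF.
by rewrite ler_pdivlMl.
Qed.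

(** [rsum] is defined by the positive and negative parts; linearity is easier
    to read off from an arbitrary difference of nonnegative families. *)
Lemma rsum_sub a b : (forall z, 0 <= a z) -> (forall z, 0 <= b z) ->
  finite_sum a -> finite_sum b -> rsum (fun z => a z - b z) = tsum a - tsum b.
Proof.
move=> a0 b0 fa fb; rewrite /rsum.
set c := fun z => a z - b z.
have p0 z : 0 <= (c^\+) z by exact: funrpos_ge0.
have n0 z : 0 <= (c^\-) z by exact: funrneg_ge0.
have pE z : (c^\+) z = Num.max (a z - b z) 0 by [].
have nE z : (c^\-) z = Num.max (- (a z - b z)) 0 by [].
have fp : finite_sum c^\+.
  apply: finite_sum_le fa => z; rewrite pE ge_max a0 andbT lerBlDr lerDl; exact: b0.
have fn : finite_sum c^\-.
  apply: finite_sum_le fb => z; rewrite nE ge_max b0 andbT opprB lerBlDr lerDl.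
  exact: a0.
apply/eqP; rewrite subr_eq addrAC eq_sym subr_eq eq_sym; apply/eqP.
rewrite -!/(tsum _) -!tsumD //; congr tsum; apply/funext => z /=.
rewrite pE nE; case: (leP (a z) (b z)) => h; last first.
- rewrite max_l ?max_r; lra.
- rewrite max_r ?max_l; lra.
Qed.

Lemma rsum_ge0E a : (forall z, 0 <= a z) -> finite_sum a -> rsum a = tsum a.
Proof.
move=> a0 fa; have -> : a = (fun z => a z - 0) by apply/funext => z; rewrite subr0.
rewrite rsum_sub //.
- rewrite [X in _ - X](_ : _ = 0) ?subr0; last by rewrite /tsum esum1.
  by congr tsum; apply/funext => z; rewrite subr0.
- by rewrite /finite_sum esum1.
Qed.

Definition abs_summable a : Prop := finite_sum (fun z => `|a z|).

Lemma abs_summable_sub a : abs_summable a -> exists p n : Z -> R,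
  [/\ forall z, 0 <= p z, forall z, 0 <= n z, finite_sum p, finite_sum n &
      a = (fun z => p z - n z)].
Proof.
move=> fa; exists (fun z => `|a z|), (fun z => `|a z| - a z); split=> //.
- by move=> z; rewrite subr_ge0 ler_norm.
- have [] := @tsumZ 2 (fun z => `|a z|) _ _ fa => // f2 _.
  apply: finite_sum_le f2 => z; rewrite mulrDl mul1r lerD2l -normrN; exact: ler_norm.
- by apply/funext => z; rewrite opprB addrC subrK.
Qed.

Lemma rsumD a b : abs_summable a -> abs_summable b ->
  rsum (fun z => a z + b z) = rsum a + rsum b.
Proof.
move=> /abs_summable_sub[p [n [p0 n0 fp fn ->]]].
move=> /abs_summable_sub[p' [n' [p0' n0' fp' fn' ->]]].
rewrite !rsum_sub // [LHS](_ : _ = rsum (fun z => (p z + p' z) - (n z + n' z))).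
  rewrite rsum_sub ?tsumD //; first ring.
  - by move=> z; rewrite addr_ge0.
  - by move=> z; rewrite addr_ge0.
  - exact: finite_sumD.
  - exact: finite_sumD.
by congr rsum; apply/funext => z; ring.
Qed.

Lemma rsumN a : abs_summable a -> rsum (fun z => - a z) = - rsum a.
Proof.
move=> /abs_summable_sub[p [n [p0 n0 fp fn ->]]]; rewrite rsum_sub // opprB -rsum_sub //.
by congr rsum; apply/funext => z; rewrite opprB.
Qed.

Lemma rsumZ c a : abs_summable a -> rsum (fun z => c * a z) = c * rsum a.
Proof.
wlog c0 : c / 0 <= c => [H fa|].
  case: (leP 0 c) => c0; first exact: H.
  have -> : (fun z => c * a z) = (fun z => - ((- c) * a z)).
    by apply/funext => z; rewrite mulNr opprK.
  have c0' : 0 <= - c by rewrite oppr_ge0 ltW.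
  rewrite rsumN ?H ?mulNr ?opprK //.
  have [] := @tsumZ (- c) (fun z => `|a z|) c0' _ fa => // f _.
  by rewrite /abs_summable; under eq_fun do rewrite normrM (ger0_norm c0').
move=> /abs_summable_sub[p [n [p0 n0 fp fn ->]]]; rewrite rsum_sub // mulrBr.
have [f1 <-] := tsumZ c0 p0 fp; have [f2 <-] := tsumZ c0 n0 fn.
rewrite -rsum_sub //; [|by move=> z; rewrite mulr_ge0..].
by congr rsum; apply/funext => z; rewrite mulrBr.
Qed.

End Esum.

(** * The real Hilbert space of square-summable families *)

Section SquareSummable.
Variables (R : realType) (Z : choiceType).

Definition sqsum : {pred Z -> R^o} := fun f => `[< finite_sum (fun z => f z ^+ 2) >].

Lemma sqsum_submod : submod_closed sqsum.
Proof.
split=> [|c f h /asboolP fL /asboolP hL]; apply/asboolP.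
  by rewrite /finite_sum esum1 // => z _; rewrite /= expr0n.
have sq0 (g : Z -> R) z : 0 <= g z ^+ 2 by exact: sqr_ge0.
have [f2 _] := tsumZ (mulr_ge0 (ler0n R 2) (sqr_ge0 c)) (sq0 f) fL.
have [h2 _] := tsumZ (ler0n R 2) (sq0 h) hL.
apply: (finite_sum_le _ (finite_sumD _ _ f2 h2)) => z.
- rewrite -subr_ge0.
  rewrite [X in X - _](_ : _ = 2 * (c * f z)^+2 + 2 * h z ^+2); last by ring.
  rewrite [X in _ - X](_ : _ = (c * f z + h z)^+2) //.
  have := sqr_ge0 (c * f z - h z); lra.
- by rewrite mulr_ge0 ?sqr_ge0 // mulr_ge0 ?sqr_ge0.
- by rewrite mulr_ge0 ?sqr_ge0.
Qed.

HB.instance Definition _ := GRing.isSubmodClosed.Build _ _ sqsum sqsum_submod.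

(** Bundling square-summability makes [ell2] a module, on which the inner
    product is bilinear without side conditions. *)
Record ell2 := Ell2 { ell2_fun :> Z -> R^o ; _ : ell2_fun \in sqsum }.

HB.instance Definition _ := [isSub for ell2_fun].
HB.instance Definition _ := [Choice of ell2 by <:].
HB.instance Definition _ := [SubChoice_isSubLmodule of ell2 by <:].

Implicit Types (f h k : ell2) (z : Z).

Lemma ell2P f : finite_sum (fun z => f z ^+ 2).
Proof. by case: f => f /= /asboolP. Qed.

Definition mk_ell2 (f : Z -> R) (H : finite_sum (fun z => f z ^+ 2)) : ell2 :=
  Ell2 (introT (asboolP _) H).

Lemma ell2_ext f h : (forall z, f z = h z) -> f = h.
Proof. by move=> fh; apply/val_inj/funext. Qed.

Lemma ell2D f h z : (f + h) z = f z + h z. Proof. by []. Qed.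
Lemma ell2B f h z : (f - h) z = f z - h z. Proof. by []. Qed.
Lemma ell2Z (c : R) f z : (c *: f) z = c * f z. Proof. by []. Qed.
Definition ip f h : R := rsum (fun z => f z * h z).

Lemma ip_abs_summable f h : abs_summable (fun z => f z * h z).
Proof.
have sq0 (g : Z -> R) z : 0 <= g z ^+ 2 by exact: sqr_ge0.
apply: (finite_sum_le _ (finite_sumD (sq0 f) (sq0 h) (ell2P f) (ell2P h))) => z.
rewrite normrM.
rewrite -(real_normK (num_real (f z))) -(real_normK (num_real (h z))).
have := sqr_ge0 (`|f z| - `|h z|); have := normr_ge0 (f z).
have := normr_ge0 (h z); nra.
Qed.

Lemma ipC f h : ip f h = ip h f.
Proof. by congr rsum; apply/funext => z; rewrite mulrC. Qed.

Lemma ipDl f h k : ip (f + h) k = ip f k + ip h k.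
Proof.
rewrite /ip -rsumD; [|exact: ip_abs_summable..].
by congr rsum; apply/funext => z; rewrite ell2D mulrDl.
Qed.

Lemma ipZl c f k : ip (c *: f) k = c * ip f k.
Proof.
rewrite /ip -rsumZ; last exact: ip_abs_summable.
by congr rsum; apply/funext => z; rewrite ell2Z mulrA.
Qed.

Lemma ipNl f k : ip (- f) k = - ip f k.
Proof. by rewrite -scaleN1r ipZl mulN1r. Qed.
Lemma ipBl f h k : ip (f - h) k = ip f k - ip h k.
Proof. by rewrite ipDl ipNl. Qed.
Lemma ip0l k : ip 0 k = 0.
Proof. by rewrite -(scale0r (0 : ell2)) ipZl mul0r. Qed.
Lemma ipDr f h k : ip k (f + h) = ip k f + ip k h.
Proof. by rewrite ipC ipDl !(ipC k). Qed.
Lemma ipZr c f k : ip k (c *: f) = c * ip k f.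
Proof. by rewrite ipC ipZl (ipC k). Qed.
Lemma ipNr f k : ip k (- f) = - ip k f.
Proof. by rewrite ipC ipNl (ipC k). Qed.

Lemma ip0r k : ip k 0 = 0.
Proof. by rewrite ipC ip0l. Qed.
Definition ipE := (ipDl, ipDr, ipNl, ipNr, ipZl, ipZr, ip0l, ip0r).

Lemma ipffE f : ip f f = tsum (fun z => f z ^+ 2).
Proof.
rewrite -rsum_ge0E; last exact: ell2P.
  by congr rsum.
by move=> z; exact: sqr_ge0.
Qed.

Lemma ip_ge0 f : 0 <= ip f f.
Proof. by rewrite ipffE tsum_ge0 // => z; exact: sqr_ge0. Qed.

Lemma sum_le_ip f (s : seq Z) : uniq s -> \sum_(z <- s) f z ^+ 2 <= ip f f.
Proof.
move=> us; rewrite ipffE; apply: sum_le_tsum => //; last exact: ell2P.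
by move=> z; exact: sqr_ge0.
Qed.

Lemma sqr_le_ip f z : f z ^+ 2 <= ip f f.
Proof. by have := @sum_le_ip f [:: z]; rewrite big_seq1; exact. Qed.

Lemma ip_eq0 f : ip f f = 0 -> f = 0.
Proof.
move=> f0; apply: ell2_ext => z; apply/eqP; rewrite -sqrf_eq0.
by rewrite eq_le sqr_ge0 andbT -f0 sqr_le_ip.
Qed.

(** The form in which a minimum gives a bound: the discriminant of a
    nonnegative quadratic polynomial is nonpositive. *)
Lemma quad_disc (a b c : R) :
  0 <= c -> (forall t, 0 <= a - 2 * t * b + t ^+ 2 * c) -> b ^+ 2 <= a * c.
Proof.
move=> c0 H; move: c0; rewrite le_eqVlt => /orP[/eqP c0|c0].
  have a0 : 0 <= a by have := H 0; rewrite mulr0 mul0r expr0n mul0r subr0 addr0.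
  case: (eqVneq b 0) => [->|b0]; first by rewrite -c0 expr0n mulr0.
  have := H ((a + 1) / (2 * b)); rewrite -c0 mulr0 addr0.
  have -> : 2 * ((a + 1) / (2 * b)) * b = a + 1 by field.
  lra.
have := H (b / c); rewrite -(pmulr_lge0 _ c0) => h; rewrite -subr_ge0.
apply: le_trans h _; rewrite le_eqVlt; apply/orP; left; apply/eqP; field.
by rewrite gt_eqF.
Qed.

Lemma cauchy_schwarz f h : ip f h ^+ 2 <= ip f f * ip h h.
Proof.
apply: quad_disc; first exact: ip_ge0.
move=> t; have := ip_ge0 (f - t *: h); rewrite !ipE (ipC h f).
by congr (0 <= _); ring.
Qed.

Lemma finite_sum_delta z0 : finite_sum (fun z => ((z == z0)%:R : R)).
Proof.
apply: (finite_sumP (M := 1) _ _).1 => [z|s us]; first exact: ler0n.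
by rewrite -natr_sum -big_mkcond /= sum1_count count_uniq_mem // lern1 leq_b1.
Qed.

Lemma tsum_delta z0 : tsum (fun z => ((z == z0)%:R : R)) = 1.
Proof.
rewrite /tsum (_ : esum _ _ = 1%E) //.
rewrite -[RHS](@esum_set1 _ _ z0 (fun=> 1%E)) // [RHS]esum_mkcond.
by apply: eq_esum => z _; rewrite in_set1; case: (z == z0).
Qed.

Definition delta z0 : ell2.
Proof.
apply: (@mk_ell2 (fun z => (z == z0)%:R)).
by under eq_fun do rewrite expr2 -natrM mulnb andbb; exact: finite_sum_delta.
Defined.

Lemma deltaE z0 z : delta z0 z = (z == z0)%:R. Proof. by []. Qed.

Lemma ip_delta f z0 : ip f (delta z0) = f z0.
Proof.
rewrite /ip -[RHS]mulr1 -(tsum_delta z0) -rsum_ge0E; last exact: finite_sum_delta.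
  rewrite -rsumZ; last first.
    by rewrite /abs_summable; under eq_fun do rewrite normr_nat; exact: finite_sum_delta.
  by congr rsum; apply/funext => z; rewrite deltaE; case: eqP => [->|]; rewrite ?mulr0.
by move=> z; exact: ler0n.
Qed.

Lemma ip_inj f h : (forall k, ip f k = ip h k) -> f = h.
Proof. by move=> H; apply: ell2_ext => z; rewrite -!ip_delta. Qed.

Lemma ip_delta_delta z0 : ip (delta z0) (delta z0) = 1.
Proof. by rewrite ip_delta deltaE eqxx. Qed.

(** Completeness, with an explicit modulus [b]: a Cauchy sequence converges
    pointwise, and the bounds on finite partial sums pass to the limit. *)
Lemma ell2_complete (u : nat -> ell2) (b : nat -> R) :
  (forall n m, (n <= m)%N -> ip (u n - u m) (u n - u m) <= b n) ->
  b @ \oo --> (0 : R) ->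
  exists h : ell2, forall n, ip (u n - h) (u n - h) <= b n.
Proof.
move=> ub b0.
have cu z : cvgn (fun n => u n z : R).
  apply: cauchy_cvg; apply/cauchy_exP => e e0.
  have e4 : 0 < e ^+ 2 by rewrite exprn_gt0.
  have [N _ HN] : \forall n \near \oo, `|0 - b n| < e ^+ 2.
    by move/cvgrPdist_lt : b0; exact.
  have H n : (N <= n)%N -> `|u N z - u n z| < e.
    move=> Nn; rewrite -(@ltr_pXn2r _ 2) ?nnegrE ?normr_ge0 ?(ltW e0) //.
    rewrite real_normK ?num_real //.
    apply: le_lt_trans (HN N (leqnn N)).
    apply: le_trans (sqr_le_ip (u N - u n) z) _.
    by apply: le_trans (ub _ _ Nn) _; rewrite sub0r normrN ler_norm.
  by exists (u N z); exists N => // n /H; rewrite /= -ball_normE.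
pose h z : R := limn (fun n => u n z : R).
have hn n : finite_sum (fun z => (u n z - h z) ^+ 2) /\
    tsum (fun z => (u n z - h z) ^+ 2) <= b n.
  apply: finite_sumP => [z|s us]; first exact: sqr_ge0.
  have cs : (fun m => \sum_(z <- s) (u n z - u m z) ^+ 2) @ \oo -->
      \sum_(z <- s) (u n z - h z) ^+ 2.
    elim: s {us} => [|z s IHs].
      by rewrite big_nil; under eq_fun do rewrite big_nil; exact: cvg_cst.
    rewrite big_cons; under eq_fun do rewrite big_cons.
    apply: cvgD IHs; rewrite expr2; under eq_fun do rewrite expr2.
    by apply: cvgM; apply: cvgB (cu z); exact: cvg_cst.
  apply: (cvgr_to_le cs); near=> m.
  apply: le_trans (ub n m _); last by near: m; exact: nbhs_infty_ge.
  exact: (@sum_le_ip (u n - u m) s us).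
pose v : ell2 := mk_ell2 (hn 0%N).1.
exists (u 0%N - v) => n; rewrite ipffE.
have -> : (fun z => (u n - (u 0%N - v)) z ^+ 2) = (fun z => (u n z - h z) ^+ 2).
  by apply/funext => z; rewrite !ell2B /v /=; congr (_ ^+ 2); ring.
exact: (hn n).2.
Unshelve. all: by end_near.
Qed.

Lemma ip_cvg (u : nat -> ell2) (b : nat -> R) h k :
  (forall n, ip (u n - h) (u n - h) <= b n) -> b @ \oo --> (0 : R) ->
  (fun n => ip (u n) k) @ \oo --> ip h k.
Proof.
move=> ub b0; apply/cvgrPdist_lt => e e0.
pose c := ip k k + 1.
have c0 : 0 < c by rewrite ltr_wpDl // ip_ge0.
have ec0 : 0 < e ^+ 2 / c by rewrite divr_gt0 // exprn_gt0.
have : \forall n \near \oo, `|0 - b n| < e ^+ 2 / c.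
  by move/cvgrPdist_lt : b0; exact.
apply: filterS => n bn.
rewrite -(@ltr_pXn2r _ 2) ?nnegrE ?normr_ge0 ?(ltW e0) //.
rewrite real_normK ?num_real // -ipBl -sqrrN -ipNl opprB.
apply: le_lt_trans (cauchy_schwarz _ _) _.
have bn' : b n < e ^+ 2 / c.
  by apply: le_lt_trans bn; rewrite sub0r normrN ler_norm.
have u0 := ip_ge0 (u n - h); have k0 := ip_ge0 k.
have := le_lt_trans (ub n) bn'; rewrite ltr_pdivlMr //; rewrite /c; nra.
Qed.

(** * Annihilators and orthogonal projections *)

Definition annihilator (W : set ell2) : set ell2 := [set f | forall w, W w -> ip f w = 0].

(** By the projection theorem the annihilators are exactly the closed linear
    subspaces; in this form closure under linear combinations, limits and
    intersections is immediate, and [annihilator (annihilator W)] is the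
    closed span of [W]. *)
Definition closed_subspace (M : set ell2) : Prop := exists W, M = annihilator W.

Section ClosedSub.
Variables (M : set ell2).
Hypothesis cM : closed_subspace M.

Lemma closed_subspace0 : M 0.
Proof. by case: cM => W -> w _; rewrite ip0l. Qed.
Lemma closed_subspaceD f h : M f -> M h -> M (f + h).
Proof. by case: cM => W -> fM hM w Ww; rewrite ipDl fM // hM // addr0. Qed.
Lemma closed_subspaceZ c f : M f -> M (c *: f).
Proof. by case: cM => W -> fM w Ww; rewrite ipZl fM // mulr0. Qed.
Lemma closed_subspaceB f h : M f -> M h -> M (f - h).
Proof.
move=> fM hM; rewrite -scaleN1r; apply: closed_subspaceD => //.
exact: closed_subspaceZ.
Qed.
Lemma closed_subspace_lim (u : nat -> ell2) (b : nat -> R) h :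
  (forall n, M (u n)) ->
  (forall n, ip (u n - h) (u n - h) <= b n) -> b @ \oo --> (0 : R) -> M h.
Proof.
case: cM => W -> uM ub b0 w Ww.
have := ip_cvg (k := w) ub b0.
have -> : (fun n => ip (u n) w) = cst 0 by apply/funext => n; exact: uM.
by move=> /cvg_lim <- //; rewrite lim_cst.
Qed.

(** The Hilbert projection theorem. For a minimizing sequence [u] the
    parallelogram law gives convergence, and comparing [u n] with
    [u n + t *: k] for all [t] shows that [f - u n] is nearly orthogonal
    to [k]. *)
Lemma proj_ex f : exists h, M h /\ forall k, M k -> ip (f - h) k = 0.
Proof.
pose E := [set ip (f - k) (f - k) | k in M].
have E0 : E !=set0 by exists (ip (f - 0) (f - 0)); exists 0 => //; exact: closed_subspace0.
have lE : lbound E 0 by move=> _ [k _ <-]; exact: ip_ge0.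
have hE : has_inf E by split=> //; exists 0.
pose D := inf E.
have Dle k : M k -> D <= ip (f - k) (f - k).
  by move=> kM; apply: ge_inf; [exists 0|exists k].
have ex n : exists k, M k /\ ip (f - k) (f - k) < D + (n.+1)%:R^-1.
  have n0 : 0 < (n.+1)%:R^-1 :> R by rewrite invr_gt0.
  by have [_ [k kM <-] lt] := inf_adherent n0 hE; exists k.
have [u uP] := choice ex.
have var n k : M k -> ip (f - u n) k ^+ 2 <= (n.+1)%:R^-1 * ip k k.
  move=> kM; apply: quad_disc; first exact: ip_ge0.
  move=> t; have := Dle (u n + t *: k) (closed_subspaceD (uP n).1 (closed_subspaceZ t kM)).
  have := (uP n).2; rewrite opprD addrA.
  move: (f - u n) => g; rewrite !ipE (ipC k g).
  move: (n.+1%:R^-1) (ip g g) (ip g k) (ip k k) => v x y w; nra.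
have cau n m : (n <= m)%N -> ip (u n - u m) (u n - u m) <= 4 * (n.+1)%:R^-1.
  move=> nm; have := Dle (2^-1 *: (u n + u m))
    (closed_subspaceZ _ (closed_subspaceD (uP n).1 (uP m).1)).
  have := (uP n).2; have := (uP m).2.
  have mn : (m.+1)%:R^-1 <= (n.+1)%:R^-1 :> R.
    by rewrite lef_pV2 ?posrE // ler_nat.
  rewrite !ipE !(ipC _ f) (ipC (u m) (u n)).
  move: (m.+1%:R^-1) (n.+1%:R^-1) mn => v v' vv.
  move: (ip f f) (ip f (u n)) (ip f (u m)) (ip (u n) (u n)) (ip (u n) (u m))
    (ip (u m) (u m)) => x1 x2 x3 x4 x5 x6; lra.
have b0 : (fun n => 4 * (n.+1)%:R^-1 : R) @ \oo --> (0 : R).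
  by rewrite -(mulr0 (4 : R)); apply: cvgM; [exact: cvg_cst|exact: cvg_harmonic].
have [h hP] := ell2_complete cau b0.
exists h; split; first exact: closed_subspace_lim (fun n => (uP n).1) hP b0.
move=> k kM; apply/eqP; rewrite -sqrf_eq0 eq_le sqr_ge0 andbT.
have c1 : (fun n => ip (f - u n) k ^+ 2) @ \oo --> ip (f - h) k ^+ 2.
  rewrite ipBl expr2; under eq_fun do rewrite ipBl expr2.
  by apply: cvgM; apply: cvgB (ip_cvg hP b0); exact: cvg_cst.
have c2 : (fun n => (n.+1)%:R^-1 * ip k k) @ \oo --> (0 : R).
  by rewrite -(mul0r (ip k k)); apply: cvgM; [exact: cvg_harmonic|exact: cvg_cst].
by apply: ler_cvg_to c1 c2 _; near=> n; exact: var.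
Unshelve. all: by end_near.
Qed.

End ClosedSub.

Definition proj (M : set ell2) f : ell2 :=
  xget 0 [set h | M h /\ forall k, M k -> ip (f - h) k = 0].

Section Proj.
Variable M : set ell2.
Hypothesis cM : closed_subspace M.

Lemma projP f : M (proj M f) /\ forall k, M k -> ip (f - proj M f) k = 0.
Proof.
have [h hP] := proj_ex cM f.
rewrite /proj; case: xgetP => [_ _ //|/(_ h)]; by case.
Qed.

Lemma proj_in f : M (proj M f). Proof. exact: (projP f).1. Qed.

Lemma ip_proj f k : M k -> ip (proj M f) k = ip f k.
Proof.
by move=> kM; apply/eqP; rewrite eq_sym -subr_eq0 -ipBl (projP f).2.
Qed.

Lemma proj_uniq f h : M h -> (forall k, M k -> ip (f - h) k = 0) -> proj M f = h.
Proof.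
move=> hM hk; apply/eqP; rewrite -subr_eq0; apply/eqP/ip_eq0.
have dM := closed_subspaceB cM (proj_in f) hM.
by rewrite ipBl ip_proj // -ipBl hk.
Qed.

Lemma proj_id f : M f -> proj M f = f.
Proof. by move=> fM; apply: proj_uniq => // k _; rewrite subrr ip0l. Qed.

Lemma proj_adj f h : ip (proj M f) h = ip f (proj M h).
Proof.
by rewrite ipC -(ip_proj h (proj_in f)) ipC ip_proj //; exact: proj_in.
Qed.

Lemma ip_proj_sq f : ip (proj M f) f = ip (proj M f) (proj M f).
Proof. by rewrite [RHS]ip_proj 1?ipC //; exact: proj_in. Qed.

Lemma proj_contr f : ip (proj M f) (proj M f) <= ip f f.
Proof.
have := ip_ge0 (f - proj M f); have := ip_proj_sq f.
by rewrite !ipE (ipC f (proj M f)) => ->; lra.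
Qed.
End Proj.

End SquareSummable.

(** * Pullback and extension by zero along an injection *)

Section PushPull.
Variables (R : realType) (Z' Z : choiceType) (phi : Z' -> Z).
Hypothesis phi_inj : injective phi.

Definition pinv (z : Z) : option Z' :=
  if pselect (exists z', phi z' = z) is left e then Some (projT1 (cid e)) else None.

Lemma pinvK z' : pinv (phi z') = Some z'.
Proof.
rewrite /pinv; case: pselect => [e|[]]; last by exists z'.
by congr Some; apply: phi_inj; exact: (projT2 (cid e)).
Qed.

Lemma pinv_Some z z' : pinv z = Some z' -> phi z' = z.
Proof.
by rewrite /pinv; case: pselect => // e [<-]; exact: (projT2 (cid e)).
Qed.

Lemma pinv_None z : ~ (exists z', phi z' = z) -> pinv z = None.
Proof. by rewrite /pinv; case: pselect. Qed.

Definition extend0 (f : Z' -> R) (z : Z) : R := oapp f 0 (pinv z).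

Lemma extend0_in f z' : extend0 f (phi z') = f z'.
Proof. by rewrite /extend0 pinvK. Qed.

Lemma extend0_out f z : ~ (exists z', phi z' = z) -> extend0 f z = 0.
Proof. by move=> /pinv_None; rewrite /extend0 => ->. Qed.

Lemma extend0_ind (P : R -> Prop) f z : P 0 -> (forall z', P (f z')) -> P (extend0 f z).
Proof. by move=> P0 Pf; rewrite /extend0; case: (pinv z) => /=. Qed.

Lemma extend0_map (op : R -> R) f z : op 0 = 0 ->
  extend0 (fun z' => op (f z')) z = op (extend0 f z).
Proof. by move=> op0; rewrite /extend0; case: (pinv z) => //=. Qed.

Lemma finite_sum_comp (a : Z -> R) : (forall z, 0 <= a z) -> finite_sum a ->
  finite_sum (a \o phi) /\ tsum (a \o phi) <= tsum a.
Proof.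
move=> a0 fa; apply: finite_sumP => [z //=|s us].
have -> : \sum_(z <- s) (a \o phi) z = \sum_(z <- map phi s) a z by rewrite big_map.
by apply: sum_le_tsum => //; rewrite map_inj_uniq.
Qed.

Lemma finite_sum_extend0 (a : Z' -> R) : (forall z, 0 <= a z) -> finite_sum a ->
  finite_sum (extend0 a) /\ tsum (extend0 a) = tsum a.
Proof.
move=> a0 fa.
have e0 z : 0 <= extend0 a z by apply: (extend0_ind (P := fun x => 0 <= x)).
have [fe le] : finite_sum (extend0 a) /\ tsum (extend0 a) <= tsum a.
  apply: finite_sumP => // s us.
  have -> : \sum_(z <- s) extend0 a z = \sum_(z' <- pmap pinv s) a z'.
    elim: s {us} => [|z s IHs]; first by rewrite !big_nil.
    rewrite big_cons IHs /= /extend0; case: (pinv z) => [z'|] /=.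
      by rewrite big_cons.
    by rewrite add0r.
  apply: sum_le_tsum => //; apply: (@map_uniq _ _ phi).
  have : subseq (map phi (pmap pinv s)) s.
    elim: s {us} => //= z s IHs; case E : (pinv z) => [z'|] /=.
      by rewrite (pinv_Some E) eqxx.
    case: (map phi _) IHs => // y l IHs; case: ifP => // _.
    by apply: subseq_trans IHs; exact: subseq_cons.
  by move/subseq_uniq; apply.
split=> //; apply/eqP; rewrite eq_le le /=.
have -> : a = extend0 a \o phi by apply/funext => z; rewrite /= extend0_in.
rewrite [X in _ <= tsum X](_ : _ = extend0 a); first exact: (finite_sum_comp _ fe).2.
by congr extend0; apply/funext => z; rewrite /= extend0_in.
Qed.

Lemma rsum_extend0 (a : Z' -> R) : abs_summable a -> rsum (extend0 a) = rsum a.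
Proof.
move=> /abs_summable_sub[p [n [p0 n0 fp fn ->]]]; rewrite [RHS]rsum_sub //.
have [fp' <-] := finite_sum_extend0 p0 fp; have [fn' <-] := finite_sum_extend0 n0 fn.
rewrite -rsum_sub //; [|by move=> z; apply: (extend0_ind (P := fun x => 0 <= x))..].
congr rsum; apply/funext => z; rewrite /extend0.
by case: (pinv z) => //=; rewrite subr0.
Qed.

Definition pull (f : ell2 R Z) : ell2 R Z' :=
  mk_ell2 (finite_sum_comp (fun z => sqr_ge0 (f z)) (ell2P f)).1.

Lemma pullE f z' : pull f z' = f (phi z'). Proof. by []. Qed.

Lemma push_finite_sum (f : ell2 R Z') : finite_sum (fun z => extend0 f z ^+ 2).
Proof.
have [fe _] := finite_sum_extend0 (fun z => sqr_ge0 (f z)) (ell2P f).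
apply: finite_sum_le fe => z.
by rewrite -(@extend0_map (fun x => x ^+ 2)) // expr0n.
Qed.

(** Pullback and push along an injection are adjoint to each other; shifts,
    matrix entries, inclusions of subsets and orbit coordinates are all built
    from these two. *)
Definition push (f : ell2 R Z') : ell2 R Z := mk_ell2 (push_finite_sum f).

Lemma pushE f z : push f z = extend0 f z. Proof. by []. Qed.

Lemma ip_push f h : ip (push f) h = ip f (pull h).
Proof.
rewrite /ip -rsum_extend0; last exact: ip_abs_summable.
congr rsum; apply/funext => z; rewrite pushE /extend0.
case E : (pinv z) => [z'|] /=; last by rewrite mul0r.
by rewrite (pinv_Some E).
Qed.

Lemma pushK f : pull (push f) = f.
Proof. by apply: ell2_ext => z; rewrite pullE pushE extend0_in. Qed.

Lemma pull_contr f : ip (pull f) (pull f) <= ip f f.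
Proof.
rewrite !ipffE; exact: (finite_sum_comp (fun z => sqr_ge0 (f z)) (ell2P f)).2.
Qed.

Lemma push_isom f : ip (push f) (push f) = ip f f.
Proof. by rewrite ip_push pushK. Qed.

End PushPull.

(** * Operators with an adjoint *)

Section Adjoint.
Variable R : realType.

(** Neither map is required to be linear: linearity follows from the
    relation, because the inner product separates points. *)
Definition adjoint_pair (Z1 Z2 : choiceType) (S : ell2 R Z1 -> ell2 R Z2)
  (S' : ell2 R Z2 -> ell2 R Z1) : Prop := forall f h, ip (S f) h = ip f (S' h).

Definition bounded_op (Z1 Z2 : choiceType) (S : ell2 R Z1 -> ell2 R Z2) : Prop :=
  exists c, 0 <= c /\ forall f, ip (S f) (S f) <= c * ip f f.

Definition kernel (Z1 Z2 : choiceType) (S : ell2 R Z1 -> ell2 R Z2) :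
  set (ell2 R Z1) := [set f | S f = 0].

Section One.
Variables (Z1 Z2 : choiceType).
Variables (S T : ell2 R Z1 -> ell2 R Z2) (S' T' : ell2 R Z2 -> ell2 R Z1).

Lemma adjC : adjoint_pair S S' -> adjoint_pair S' S.
Proof. by move=> a f h; rewrite ipC -a ipC. Qed.

Lemma adjD : adjoint_pair S S' -> {morph S : f h / f + h}.
Proof. by move=> a f h; apply: ip_inj => k; rewrite a !ipDl !a. Qed.
Lemma adjZ c : adjoint_pair S S' -> {morph S : f / c *: f}.
Proof. by move=> a f; apply: ip_inj => k; rewrite a !ipZl !a. Qed.
Lemma adjN : adjoint_pair S S' -> {morph S : f / - f}.
Proof. by move=> a f; apply: ip_inj => k; rewrite a !ipNl !a. Qed.
Lemma adjB : adjoint_pair S S' -> {morph S : f h / f - h}.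
Proof. by move=> a f h; rewrite (adjD a) (adjN a). Qed.
Lemma adj0 : adjoint_pair S S' -> S 0 = 0.
Proof. by move=> a; rewrite -(scale0r (0 : ell2 R Z1)) (adjZ _ a) scale0r. Qed.

Lemma adj_add : adjoint_pair S S' -> adjoint_pair T T' ->
  adjoint_pair (fun f => S f + T f) (fun f => S' f + T' f).
Proof. by move=> a b f h; rewrite ipDl ipDr a b. Qed.
Lemma adj_opp : adjoint_pair S S' -> adjoint_pair (fun f => - S f) (fun f => - S' f).
Proof. by move=> a f h; rewrite ipNl ipNr a. Qed.
Lemma adj_scale c : adjoint_pair S S' ->
  adjoint_pair (fun f => c *: S f) (fun f => c *: S' f).
Proof. by move=> a f h; rewrite ipZl ipZr a. Qed.
Lemma adj_zero : adjoint_pair (fun _ : ell2 R Z1 => 0 : ell2 R Z2) (fun _ => 0).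
Proof. by move=> f h; rewrite ip0l ip0r. Qed.

Lemma bounded_add : bounded_op S -> bounded_op T -> bounded_op (fun f => S f + T f).
Proof.
move=> [c [c0 Hc]] [d [d0 Hd]]; exists (2 * c + 2 * d); split=> [|f].
  by rewrite addr_ge0 // mulr_ge0.
have := ip_ge0 (S f - T f); have := Hc f; have := Hd f.
rewrite !ipE (ipC (T f) (S f)); lra.
Qed.
Lemma bounded_scale c : bounded_op S -> bounded_op (fun f => c *: S f).
Proof.
move=> [d [d0 Hd]]; exists (c ^+ 2 * d); split=> [|f].
  by rewrite mulr_ge0 // sqr_ge0.
by rewrite ipZl ipZr -mulrA mulrA -expr2 ler_wpM2l ?sqr_ge0.
Qed.
Lemma bounded_zero : bounded_op (fun _ : ell2 R Z1 => 0 : ell2 R Z2).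
Proof. by exists 0; split=> // f; rewrite ip0l mul0r. Qed.

Lemma closed_kernel : adjoint_pair S S' -> closed_subspace (kernel S).
Proof.
move=> a; exists (range S'); apply/seteqP; split=> f /=.
  by move=> Sf w [h _ <-]; rewrite -a Sf ip0l.
move=> H; apply: ip_eq0; rewrite a; apply: H; by exists (S f).
Qed.

End One.

Lemma adj_comp (Z1 Z2 Z3 : choiceType) (S : ell2 R Z2 -> ell2 R Z3) S'
    (T : ell2 R Z1 -> ell2 R Z2) T' :
  adjoint_pair S S' -> adjoint_pair T T' -> adjoint_pair (S \o T) (T' \o S').
Proof. by move=> a b f h; rewrite /= a b. Qed.

Lemma bounded_comp (Z1 Z2 Z3 : choiceType) (S : ell2 R Z2 -> ell2 R Z3)
    (T : ell2 R Z1 -> ell2 R Z2) :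
  bounded_op S -> bounded_op T -> bounded_op (S \o T).
Proof.
move=> [c [c0 Hc]] [d [d0 Hd]]; exists (c * d); split=> [|f]; first exact: mulr_ge0.
by apply: le_trans (Hc _) _; rewrite -mulrA ler_wpM2l.
Qed.

Lemma closed_subspaceI (Z : choiceType) (M N : set (ell2 R Z)) :
  closed_subspace M -> closed_subspace N -> closed_subspace (M `&` N).
Proof.
move=> [V ->] [W ->]; exists (V `|` W); apply/seteqP; split=> f.
  by move=> [fV fW] w [/fV|/fW].
by move=> H; split=> w Hw; apply: H; [left|right].
Qed.

Lemma adj_iter (Z : choiceType) (C : ell2 R Z -> ell2 R Z) n :
  adjoint_pair C C -> adjoint_pair (iter n C) (iter n C).
Proof.
move=> a; elim: n => [//|n IH] f h; by rewrite iterS a IH -iterSr.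
Qed.

(** A diagonal coefficient of a projection is a squared norm,
    [<P e, e> = |P e|^2], and [|P1 e1|^2 = <A (P1 e1), P2 e2>] by the
    hypotheses on [A]; the Cauchy-Schwarz inequality concludes. Every transfer
    of dimensions between two spaces below is an instance. *)
Lemma proj_mono (Z1 Z2 : choiceType) (M1 : set (ell2 R Z1)) (M2 : set (ell2 R Z2))
    (A : ell2 R Z1 -> ell2 R Z2) e1 e2 :
  closed_subspace M1 -> closed_subspace M2 -> (forall f, M1 f -> M2 (A f)) ->
  (forall f, ip (A f) (A f) <= ip f f) ->
  (forall f, ip (A f) e2 = ip f e1) ->
  ip (proj M1 e1) e1 <= ip (proj M2 e2) e2.
Proof.
move=> c1 c2 AM Ac Ae; rewrite !ip_proj_sq //.
set p := proj M1 e1; set q := proj M2 e2.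
have px : ip p p = ip (A p) q.
  rewrite -ip_proj_sq // -Ae ipC [RHS]ipC; symmetry.
  have H := ip_proj c2 e2 (AM _ (proj_in c1 e1)); exact: H.
have := cauchy_schwarz (A p) q; rewrite -px.
have := Ac p; have := ip_ge0 p; have := ip_ge0 q.
move: (ip p p) (ip q q) (ip (A p) (A p)) => x y z y0 x0 zx H.
case: (leP x y) => // yx; have {}H : x ^+ 2 <= x * y.
  by apply: le_trans H _; rewrite ler_wpM2r.
nra.
Qed.

Section Powers.
Variables (Z : choiceType) (C : ell2 R Z -> ell2 R Z).
Hypotheses (aC : adjoint_pair C C) (C0 : forall f, 0 <= ip (C f) f)
  (C1 : forall f, ip (C f) f <= ip f f).

(** The Cauchy-Schwarz inequality for the form [<C f, h>] gives
    [C ^ 2 <= C]. *)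
Lemma pos_contr_sq g : ip (C g) (C g) <= ip (C g) g.
Proof.
have H : ip (C g) (C g) ^+ 2 <= ip (C g) g * ip (C (C g)) (C g).
  apply: quad_disc => // t.
  have := C0 (g - t *: C g).
  rewrite (adjB aC) (adjZ _ aC) !ipE (aC (C g) g).
  by congr (0 <= _); ring.
have := C1 (C g); have := C0 g; have := ip_ge0 (C g).
move: H; move: (ip (C g) (C g)) (ip (C g) g) (ip (C (C g)) (C g)) => x y z H x0 y0 zx.
have {}H : x ^+ 2 <= y * x by apply: le_trans H _; rewrite ler_wpM2l.
case: (leP x y) => // yx; nra.
Qed.

(** The moments [<C^n e, e>] decrease to a limit because [0 <= C^2 <= C <= 1],
    and [|C^n e - C^m e|^2] is a combination of them, so the powers converge.
    The limit is the projection of [e] onto the fixed vectors of [C]. *)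
Lemma powers_cvg e : exists h, [/\ C h = h,
  forall k, (fun n => ip (iter n C e) k) @ \oo --> ip h k &
  forall k, C k = k -> ip h k = ip e k].
Proof.
pose u n := iter n C e; pose a n := ip (u n) e.
have uu n m : ip (u n) (u m) = a (n + m)%N.
  by rewrite /a /u iterD [RHS](adj_iter n aC) ipC.
have parity n : exists m, n = (m + m)%N \/ n = (m + m).+1.
  exists n./2; have := odd_double_half n; rewrite -addnn.
  by case: (odd n) => E; [right|left]; rewrite -[LHS]E.
have a_ge0 n : 0 <= a n.
  have [m [->|->]] := parity n.
  - by rewrite -uu ip_ge0.
  - by rewrite -addnS -uu ipC; exact: C0.
have a_dec n : a n.+1 <= a n.
  have [m [->|->]] := parity n.
  - by rewrite -addnS -!uu ipC; exact: C1.
  - have -> : (m + m).+2 = (m.+1 + m.+1)%N by rewrite addSn addnS.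
    by rewrite -[(m + m).+1]addSn -!uu; exact: pos_contr_sq.
have a_ni : nonincreasing_seq a by apply/nonincreasing_seqP.
have lba : has_lbound (range a) by exists 0 => _ [n _ <-].
have a_cvg := nonincreasing_cvgn a_ni lba.
have l_le n : inf (range a) <= a n by apply: ge_inf => //; exists n.
set l := inf (range a) in a_cvg l_le.
pose b n := a (n + n)%N - l.
have cau n m : (n <= m)%N -> ip (u n - u m) (u n - u m) <= b n.
  move=> nm; have := l_le (n + m)%N.
  have : a (m + m)%N <= a (n + m)%N by apply: a_ni; rewrite leq_add2r.
  rewrite !ipE !uu (addnC m n) /b; lra.
have b0 : b @ \oo --> (0 : R).
  rewrite -(subrr l); apply: cvgB; last exact: cvg_cst.
  have : (n + n)%N @[n --> \oo] --> \oo.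
    apply/cvgnyPge => N; near=> n.
    by apply: leq_trans (leq_addr _ _); near: n; exact: nbhs_infty_ge.
  by move=> /cvg_comp; apply.
have [h hP] := ell2_complete cau b0.
have hl k : (fun n => ip (u n) k) @ \oo --> ip h k by exact: ip_cvg hP b0.
exists h; split=> // [|k Ck].
  apply: ip_inj => k; rewrite aC.
  have := hl k; rewrite -cvg_shiftS /=.
  have -> : (fun n => ip (u n.+1) k) = (fun n => ip (u n) (C k)).
    by apply/funext => n; rewrite /u iterS aC.
  by apply: cvg_unique (hl (C k)).
have := hl k.
have -> : (fun n => ip (u n) k) = cst (ip e k).
  apply/funext => n; rewrite /u (adj_iter n aC).
  by congr ip; elim: n => //= n ->.
by move/cvg_lim => <- //; rewrite lim_cst.
Unshelve. all: by end_near.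
Qed.
End Powers.

(** The vectors fixed by [1 - A' A] form the kernel of [A], since
    [<A' A f, f> = |A f|^2]. *)
Lemma powers_kernel (Z1 Z2 : choiceType) (A : ell2 R Z1 -> ell2 R Z2) A' e :
  adjoint_pair A A' -> (forall f, ip (A f) (A f) <= ip f f) ->
  (fun n => ip (iter n (fun f => f - A' (A f)) e) e) @ \oo -->
  ip (proj (kernel A) e) e.
Proof.
move=> aA Ac; set C := fun f => f - A' (A f).
have aC : adjoint_pair C C.
  by move=> f h; rewrite /C !ipE (adjC aA) -aA.
have CE f : ip (C f) f = ip f f - ip (A f) (A f).
  by rewrite /C !ipE (adjC aA).
have C0 f : 0 <= ip (C f) f by rewrite CE subr_ge0.
have C1 f : ip (C f) f <= ip f f by rewrite CE lerBlDr lerDl ip_ge0.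
have [h [Ch hl hk]] := powers_cvg aC C0 C1 e.
have -> : proj (kernel A) e = h.
  apply: proj_uniq; first exact: closed_kernel aA.
    by apply: ip_eq0; have := CE h; rewrite Ch; lra.
  move=> k Ak; rewrite ipBl hk ?subrr //.
  by rewrite /C Ak (adj0 (adjC aA)) subr0.
exact: hl.
Qed.

End Adjoint.

(** * Sums over a product with a finite set *)

Section ProdSum.
Variables (R : realType) (J : finType) (T : choiceType).

Lemma pair_inj (j : J) : injective (fun t : T => (j, t)).
Proof. by move=> t t' []. Qed.

Lemma finite_sum_big (Z : choiceType) (I : Type) (s : seq I) (a : I -> Z -> R) :
  (forall i z, 0 <= a i z) -> (forall i, finite_sum (a i)) ->
  finite_sum (fun z => \sum_(i <- s) a i z) /\
  tsum (fun z => \sum_(i <- s) a i z) = \sum_(i <- s) tsum (a i).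
Proof.
move=> a0 fa; elim: s => [|i s [f1 e1]].
  rewrite big_nil; under [X in finite_sum X]eq_fun do rewrite big_nil.
  under [X in tsum X]eq_fun do rewrite big_nil.
  by rewrite /finite_sum /tsum esum1.
have s0 z : 0 <= \sum_(i <- s) a i z by apply: sumr_ge0.
rewrite big_cons; under [X in finite_sum X]eq_fun do rewrite big_cons.
under [X in tsum X]eq_fun do rewrite big_cons.
by rewrite tsumD // -e1; split=> //; exact: finite_sumD.
Qed.

Lemma slice_sum (a : J * T -> R) :
  a = (fun z => \sum_j extend0 (fun t => (j, t)) (fun t => a (j, t)) z).
Proof.
apply/funext => -[j t]; rewrite (bigD1 j) //= big1 ?addr0 => [|i ij].
  by rewrite (extend0_in (@pair_inj j) (fun t => a (j, t))).
by apply: extend0_out => -[t' [e _]]; rewrite e eqxx in ij.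
Qed.

Lemma tsum_slice (a : J * T -> R) : (forall z, 0 <= a z) ->
  (forall j, finite_sum (fun t => a (j, t))) ->
  finite_sum a /\ tsum a = \sum_j tsum (fun t => a (j, t)).
Proof.
move=> a0 fa.
have E j := finite_sum_extend0 (@pair_inj j) (fun t => a0 (j, t)) (fa j).
have E0 j z : 0 <= extend0 (fun t => (j, t)) (fun t => a (j, t)) z.
  by apply: (@extend0_ind R _ _ _ (fun x => 0 <= x)).
have [f e] := finite_sum_big (index_enum J) E0 (fun j => (E j).1).
rewrite [X in finite_sum X]slice_sum [X in tsum X]slice_sum; split=> //.
by rewrite e; apply: eq_bigr => j _; rewrite (E j).2.
Qed.

Lemma finite_sum_slice (a : J * T -> R) j : (forall z, 0 <= a z) -> finite_sum a ->
  finite_sum (fun t => a (j, t)).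
Proof. by move=> a0 fa; exact: (finite_sum_comp (@pair_inj j) a0 fa).1. Qed.

Lemma rsum_slice (a : J * T -> R) : abs_summable a ->
  rsum a = \sum_j rsum (fun t => a (j, t)).
Proof.
move=> /abs_summable_sub[p [n [p0 n0 fp fn ->]]]; rewrite rsum_sub //.
have fpj j := finite_sum_slice j p0 fp; have fnj j := finite_sum_slice j n0 fn.
rewrite (tsum_slice p0 fpj).2 (tsum_slice n0 fnj).2 -sumrB.
by apply: eq_bigr => j _; rewrite rsum_sub.
Qed.

End ProdSum.

(** * Trace, dimension and rank over a group *)

Section GroupDimension.
Variables (R : realType) (J : finType) (H : groupType).
Local Notation E := (ell2 R (J * H)%type).

Definition group_unit (j : J) : E := delta R (j, 1%g).

Definition translate_index (v : H) (z : J * H) : J * H := (z.1, (z.2 * v)%g).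

Lemma translate_index_inj v : injective (translate_index v).
Proof. by move=> [j x] [k y] [-> /mulIg ->]. Qed.

(** Right translation, which commutes with left convolution; its matrix
    coefficients at the unit vectors determine an equivariant operator. *)
Definition translate (v : H) : E -> E := pull (@translate_index_inj v).

Lemma translateE v f j x : translate v f (j, x) = f (j, (x * v)%g).
Proof. by []. Qed.

Lemma translate_adj v : adjoint_pair (translate v) (translate v^-1).
Proof.
move=> f h.
transitivity (ip (push (@translate_index_inj v^-1) f) h); last exact: ip_push.
congr (ip _ h); apply: ell2_ext => -[j x]; rewrite pushE.
have -> : (j, x) = translate_index v^-1 (j, (x * v)%g) by rewrite /translate_index /= mulgK.
by rewrite (extend0_in (@translate_index_inj v^-1)) translateE /translate_index /= mulgK.
Qed.

Lemma group_unit_translate j u : translate u^-1 (group_unit j) = delta R (j, u).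
Proof.
apply: ell2_ext => -[k x]; rewrite translateE !deltaE !xpair_eqE.
by rewrite -(inj_eq (mulIg u)) mulgVK mul1g.
Qed.

Definition equivariant (S : E -> E) : Prop :=
  forall v f, S (translate v f) = translate v (S f).

Definition invariant (M : set E) : Prop := forall v f, M f -> M (translate v f).

Lemma equivariant_adj S S' : adjoint_pair S S' -> equivariant S -> equivariant S'.
Proof.
move=> a eS v f; apply: ip_inj => k.
by rewrite (adjC a) (translate_adj v) -eS -(adjC a) -(translate_adj v).
Qed.

Lemma equivariant_proj M : closed_subspace M -> invariant M -> equivariant (proj M).
Proof.
move=> cM iM v f; apply: proj_uniq => //; first by apply: iM; exact: proj_in.
move=> k kM; rewrite -(adjB (translate_adj v)) (translate_adj v).
by apply: (projP cM f).2; exact: iM.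
Qed.

Lemma invariant_kernel S : equivariant S -> invariant (kernel S).
Proof. by move=> eS v f Sf; rewrite /kernel /= eS Sf; apply: ell2_ext. Qed.

Lemma norm_slice (f : E) : ip f f = \sum_j tsum (fun x => f (j, x) ^+ 2).
Proof.
rewrite ipffE; apply: (tsum_slice _ _).2 => [z|j]; first exact: sqr_ge0.
by apply: (@finite_sum_slice R J H (fun z => f z ^+ 2));
  [move=> z; exact: sqr_ge0|exact: ell2P].
Qed.

Lemma tsum_inv (a : H -> R) : (forall x, 0 <= a x) -> finite_sum a ->
  tsum (fun x => a x^-1)%g = tsum a.
Proof.
move=> a0 fa; have i : injective (fun x : H => x^-1)%g by exact: invg_inj.
have [f1 l1] := finite_sum_comp i a0 fa.
have [_ l2] := finite_sum_comp i (fun x => a0 x^-1)%g f1.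
apply/eqP; rewrite eq_le l1 /=; apply: le_trans l2.
by rewrite le_eqVlt (_ : _ \o _ = a) ?eqxx //; apply/funext => x /=; rewrite invgK.
Qed.

(** The trace property [tr (S^* S) = tr (S S^* )]. By equivariance the matrix
    coefficient of [S] from [(a, 1)] to [(b, x)] is that of [S'] from
    [(b, 1)] to [(a, x^-1)], so both sides are the same sum of squares. *)
Lemma trace_sq S S' : adjoint_pair S S' -> equivariant S ->
  \sum_a ip (S (group_unit a)) (S (group_unit a)) =
  \sum_a ip (S' (group_unit a)) (S' (group_unit a)).
Proof.
move=> aS eS; have eS' := equivariant_adj aS eS.
have key a b x : S (group_unit a) (b, x) = S' (group_unit b) (a, x^-1)%g.
  rewrite -ip_delta aS -group_unit_translate eS' ipC [group_unit a]/group_unit.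
  by rewrite ip_delta translateE mul1g.
under eq_bigr do rewrite norm_slice.
under [RHS]eq_bigr do rewrite norm_slice.
rewrite exchange_big /=; apply: eq_bigr => b _; apply: eq_bigr => a _.
under eq_fun do rewrite key.
rewrite (tsum_inv (a := fun x => S' (group_unit b) (a, x) ^+ 2)) //.
  by move=> x; exact: sqr_ge0.
by apply: (@finite_sum_slice R J H (fun z => S' (group_unit b) z ^+ 2));
  [move=> z; exact: sqr_ge0|exact: ell2P].
Qed.

(** The trace property [tr (T^* S) = tr (S T^* )], by polarization. *)
Lemma trace_ip S S' T T' : adjoint_pair S S' -> adjoint_pair T T' ->
  equivariant S -> equivariant T ->
  \sum_a ip (S (group_unit a)) (T (group_unit a)) =
  \sum_a ip (T' (group_unit a)) (S' (group_unit a)).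
Proof.
move=> aS aT eS eT.
have e1 := trace_sq (adj_add aS aT) _.
have e2 := trace_sq (adj_add aS (adj_opp aT)) _.
have t v (f h : E) : translate v (f + h) = translate v f + translate v h.
  exact: (adjD (translate_adj v)).
have tN v (f : E) : translate v (- f) = - translate v f.
  exact: (adjN (translate_adj v)).
have {}e1 := e1 (fun v f => _).
have pol (f h : J -> E) : \sum_a ip (f a) (h a) =
    (\sum_a ip (f a + h a) (f a + h a) - \sum_a ip (f a - h a) (f a - h a)) / 4.
  rewrite -sumrB mulr_suml; apply: eq_bigr => a _.
  by rewrite !ipE (ipC (h a) (f a)); field.
under [RHS]eq_bigr do rewrite ipC.
rewrite [LHS]pol [RHS]pol e1 ?e2 //.
- by move=> v f; rewrite eS eT t tN.
- by move=> v f; rewrite eS eT t.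
Qed.

Definition real_dim (M : set E) : R := \sum_j ip (proj M (group_unit j)) (group_unit j).

Lemma equivariant_iter C n : equivariant C -> equivariant (iter n C).
Proof. by move=> eC; elim: n => // n IH v f; rewrite !iterS IH eC. Qed.

(** Put [C = 1 - A' A] and [D = 1 - A A']. Telescoping and the trace property
    turn the trace of [1 - C^n] into that of [1 - D^n], and [C A' = A' D]. At
    a unit vector killed by [A'] the latter contributes [0]; at the others, at
    most [1], provided that [D^n] is nonnegative. *)
Lemma rank_bound A A' (F : {pred J}) : adjoint_pair A A' -> equivariant A ->
  (forall f, ip (A f) (A f) <= ip f f) ->
  (forall j, j \notin F -> A' (group_unit j) = 0) ->
  #|J|%:R - real_dim (kernel A) <= #|F|%:R.
Proof.
move=> aA eA Ac AF; have eA' := equivariant_adj aA eA.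
pose C f := f - A' (A f); pose D f := f - A (A' f).
have aC : adjoint_pair C C by move=> f h; rewrite /C !ipE (adjC aA) -aA.
have aD : adjoint_pair D D by move=> f h; rewrite /D !ipE aA -(adjC aA).
have eC : equivariant C.
  by move=> v f; rewrite /C eA eA' (adjB (translate_adj v)).
have CA n f : iter n C (A' f) = A' (iter n D f).
  elim: n f => // n IH f; rewrite !iterS IH /C /D.
  by rewrite (adjB (adjC aA)).
have tele n e : ip e e - ip (iter n C e) e = \sum_(i < n) ip (A e) (A (iter i C e)).
  elim: n => [|n IH]; first by rewrite big_ord0 subrr.
  rewrite big_ord_recr /= -IH.
  rewrite {1}/C ipBl (adjC aA) (ipC (A (iter n C e))); ring.
have tele2 n e : \sum_(i < n) ip (A' e) (iter i C (A' e)) = ip e e - ip (iter n D e) e.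
  elim: n => [|n IH]; first by rewrite big_ord0 subrr.
  rewrite big_ord_recr /= IH CA; set x := iter n D e.
  have -> : ip (D x) e = ip x e - ip (A' x) (A' e) by rewrite /D ipBl aA.
  by rewrite (ipC (A' x)); ring.
have swap i : \sum_j ip (A (group_unit j)) (A (iter i C (group_unit j))) =
    \sum_j ip (A' (group_unit j)) (iter i C (A' (group_unit j))).
  rewrite (trace_ip aA (adj_comp aA (adj_iter i aC)) eA).
    by apply: eq_bigr => b _; rewrite ipC.
  by move=> v f /=; rewrite (equivariant_iter i eC) eA.
(* For an even exponent [D ^ (m + m)] is the square of a self-adjoint operator. *)
have bound m : \sum_j (1 - ip (iter (m + m) C (group_unit j)) (group_unit j)) <= #|F|%:R.
  under eq_bigr => j _ do rewrite -[1](@ip_delta_delta R (J * H)%type (j, 1%g)) tele.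
  rewrite exchange_big /=; under eq_bigr do rewrite swap.
  rewrite exchange_big /= -sum1_card natr_sum [leRHS]big_mkcond /=.
  apply: ler_sum => b _; case: ifP => [bF|/negbT /AF A0].
    rewrite tele2 iterD (adj_iter m aD) ip_delta_delta gerBl; exact: ip_ge0.
  by rewrite big1 // => i _; rewrite A0 ip0l.
have cv : (fun n => \sum_j (1 - ip (iter n C (group_unit j)) (group_unit j))) @ \oo -->
    #|J|%:R - real_dim (kernel A).
  have -> : #|J|%:R - real_dim (kernel A) =
      \sum_j (1 - ip (proj (kernel A) (group_unit j)) (group_unit j)).
    by rewrite sumrB sumr_const.
  elim: (index_enum J) => [|j s IH].
    by rewrite big_nil; under eq_fun do rewrite big_nil; exact: cvg_cst.
  rewrite big_cons; under eq_fun do rewrite big_cons.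
  apply: cvgD IH; apply: cvgB; first exact: cvg_cst.
  exact: powers_kernel.
have dbl : (n + n)%N @[n --> \oo] --> \oo.
  apply/cvgnyPge => N; near=> n.
  by apply: leq_trans (leq_addr _ _); near: n; exact: nbhs_infty_ge.
have := cvg_comp _ _ dbl cv => /cvgr_to_le; apply.
by near=> m; exact: bound.
Unshelve. all: by end_near.
Qed.

(** The rank inequality on an invariant subspace [M], obtained from
    [rank_bound] for [A = T P], with [P] the projection onto [M]: its kernel
    is the orthogonal sum of [M `&` kernel T] and the complement of [M]. *)
Lemma real_dim_kernel M T T' (F : {pred J}) : closed_subspace M -> invariant M ->
  adjoint_pair T T' -> bounded_op T -> equivariant T ->
  (forall j, j \notin F -> T' (group_unit j) = 0) ->
  real_dim M <= real_dim (M `&` kernel T) + #|F|%:R.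
Proof.
move=> cM iM aT [c [c0 Tc]] eT TF.
have cK := closed_kernel aT; have cMK := closed_subspaceI cM cK.
(* [T] is rescaled to a contraction, which does not change its kernel. *)
pose s : R := (c + 1)^-1.
have c1 : 0 < c + 1 by lra.
have s0 : 0 < s by rewrite invr_gt0.
pose A f := s *: T (proj M f); pose A' f := proj M (s *: T' f).
have aA : adjoint_pair A A'.
  by move=> f h; rewrite /A /A' ipZl aT proj_adj // -ipZr -(adjZ s (proj_adj cM)).
have eP := equivariant_proj cM iM.
have eA : equivariant A.
  move=> v f; rewrite /A eP eT; by rewrite (adjZ s (translate_adj v)).
have s1 : s ^+ 2 * c <= 1.
  rewrite /s exprVn -ler_pdivlMl ?invr_gt0 ?exprn_gt0 // invrK mulr1; nra.
have Ac f : ip (A f) (A f) <= ip f f.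
  apply: le_trans (proj_contr cM f).
  rewrite /A ipZl ipZr mulrA -expr2.
  apply: (@le_trans _ _ (s ^+ 2 * (c * ip (proj M f) (proj M f)))).
    by rewrite ler_wpM2l // sqr_ge0.
  by rewrite mulrA ler_piMl // ip_ge0.
have AF j : j \notin F -> A' (group_unit j) = 0.
  by move=> /TF jF; rewrite /A' jF scaler0 proj_id //; exact: closed_subspace0.
have := rank_bound aA eA Ac AF.
suff -> : real_dim (kernel A) = real_dim (M `&` kernel T) + (#|J|%:R - real_dim M) by lra.
have -> : #|J|%:R - real_dim M = \sum_j (1 - ip (proj M (group_unit j)) (group_unit j)).
  by rewrite sumrB sumr_const.
rewrite -big_split /=; apply: eq_bigr => j _.
set e := group_unit j.
have -> : proj (kernel A) e = proj (M `&` kernel T) e + (e - proj M e).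
  apply: proj_uniq; first exact: closed_kernel aA.
    have [N1 N2] := proj_in cMK e.
    rewrite /kernel /= /A (adjD (proj_adj cM)) (adjB (proj_adj cM)).
    rewrite (proj_id cM N1) (proj_id cM (proj_in cM e)) subrr addr0.
    by rewrite N2 scaler0.
  move=> k Ak; rewrite opprD addrA addrAC.
  have -> : e - (e - proj M e) - proj (M `&` kernel T) e =
     proj M e - proj (M `&` kernel T) e by rewrite opprB [e + _]addrC subrK.
  have kT : T (proj M k) = 0.
    by move/eqP : Ak; rewrite scaler_eq0 gt_eqF //= => /eqP.
  have kM := proj_in cM k.
  have [N1 N2] := proj_in cMK e.
  rewrite ipBl proj_adj // -(proj_id cM N1) proj_adj //.
  by rewrite (ip_proj cMK e (conj kM kT)) subrr.
by rewrite ipDl ipBl ip_delta_delta.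
Qed.

End GroupDimension.

(** * Convolution operators *)

Section ConvolutionOperators.
Variables (R : realType) (G : groupType) (J : finType).
Variables (W : seq G) (c : J -> J -> G -> R).

Section OnSpace.
Variables (X : choiceType) (act : G -> X -> X).
Hypothesis actP : left_action act.

Lemma act_inj g : injective (act g).
Proof.
case: actP => a1 aM x y e.
by rewrite -[x]a1 -[y]a1 -(mulVg g) !aM e.
Qed.

Lemma actK g x : act g (act g^-1 x) = x.
Proof. by case: actP => a1 aM; rewrite -aM mulgV a1. Qed.
Lemma actVK g x : act g^-1 (act g x) = x.
Proof. by case: actP => a1 aM; rewrite -aM mulVg a1. Qed.

Lemma shift_inj (l : J) (g : G) : injective (fun x : X => (l, act g^-1 x)).
Proof. by move=> x y [/act_inj]. Qed.

(** The operator of a matrix over the real group ring ([conv_opE]), assembled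
    from pushes and pulls so that its adjoint and its boundedness come for
    free. *)
Definition conv_op (f : ell2 R (J * X)%type) : ell2 R (J * X)%type :=
  \sum_(p : J * J) \sum_(g <- W)
    c p.1 p.2 g *: push (@pair_inj J X p.1) (pull (@shift_inj p.2 g) f).

Definition conv_op_adj (f : ell2 R (J * X)%type) : ell2 R (J * X)%type :=
  \sum_(p : J * J) \sum_(g <- W)
    c p.1 p.2 g *: push (@shift_inj p.2 g) (pull (@pair_inj J X p.1) f).

Lemma ell2_sum (Z : choiceType) (I : Type) (s : seq I) (F : I -> ell2 R Z) z :
  (\sum_(i <- s) F i) z = \sum_(i <- s) F i z.
Proof.
by elim: s => [|i s IH]; rewrite ?big_nil // !big_cons ell2D IH.
Qed.

Lemma conv_opE f j x :
  conv_op f (j, x) = \sum_l \sum_(g <- W) c j l g * f (l, act g^-1 x).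
Proof.
rewrite /conv_op ell2_sum -(pair_bigA _ (fun j' l => (\sum_(g <- W)
    c j' l g *: push (@pair_inj J X j') (pull (@shift_inj l g) f)) (j, x))) /=.
rewrite (bigD1 j) //= [X in _ + X]big1 ?addr0 => [|j' jj'].
  apply: eq_bigr => l _; rewrite ell2_sum; apply: eq_bigr => g _.
  by rewrite ell2Z pushE (extend0_in (@pair_inj J X j)).
rewrite big1 // => l _; rewrite ell2_sum big1 // => g _.
rewrite ell2Z pushE extend0_out ?mulr0 // => -[x' [e _]].
by rewrite e eqxx in jj'.
Qed.

Lemma conv_op_adjP : adjoint_pair conv_op conv_op_adj /\ bounded_op conv_op.
Proof.
have sumP (I : Type) (s : seq I) (S S' : I -> ell2 R (J * X)%type -> ell2 R (J * X)%type) :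
    (forall i, adjoint_pair (S i) (S' i) /\ bounded_op (S i)) ->
    adjoint_pair (fun f => \sum_(i <- s) S i f) (fun f => \sum_(i <- s) S' i f) /\
    bounded_op (fun f => \sum_(i <- s) S i f).
  move=> H; elim: s => [|i s [IH1 IH2]].
    under [X in adjoint_pair X]eq_fun do rewrite big_nil.
    under [X in adjoint_pair _ X]eq_fun do rewrite big_nil.
    under [X in bounded_op X]eq_fun do rewrite big_nil.
    by split; [exact: adj_zero|exact: bounded_zero].
  under [X in adjoint_pair X]eq_fun do rewrite big_cons.
  under [X in adjoint_pair _ X]eq_fun do rewrite big_cons.
  under [X in bounded_op X]eq_fun do rewrite big_cons.
  by have [H1 H2] := H i; split; [exact: adj_add|exact: bounded_add].
apply: (sumP) => p; apply: (sumP) => g; split.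
  apply: adj_scale => f h.
  by rewrite ip_push ipC -ip_push ipC.
apply: bounded_scale; exists 1; split=> // f; rewrite mul1r push_isom.
exact: pull_contr.
Qed.
End OnSpace.

End ConvolutionOperators.

(** * The kernel of a compression *)

Lemma mul_left_action (G : groupType) : left_action (fun g x : G => (g * x)%g).
Proof. by split=> [x|g h x]; rewrite ?mul1g ?mulgA. Qed.

Section Restriction.
Variables (R : realType) (J : finType) (H : groupType) (F : {pred J}).

Lemma truncate_finite_sum (f : ell2 R (J * H)%type) :
  finite_sum (fun z : J * H => ((z.1 \in F)%:R * f z) ^+ 2).
Proof.
apply: finite_sum_le (ell2P f) => z; case: (z.1 \in F); rewrite ?mul1r //.
by rewrite mul0r expr0n sqr_ge0.
Qed.

Definition truncate (f : ell2 R (J * H)%type) : ell2 R (J * H)%type :=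
  mk_ell2 (truncate_finite_sum f).

Lemma truncateE f z : truncate f z = (z.1 \in F)%:R * f z. Proof. by []. Qed.

Lemma truncate_adj : adjoint_pair truncate truncate.
Proof.
move=> f h; congr rsum; apply/funext => z.
by rewrite !truncateE mulrCA mulrA.
Qed.

Lemma truncate_bounded : bounded_op truncate.
Proof.
exists 1; split=> // f; rewrite mul1r.
have RR : truncate (truncate f) = truncate f.
  apply: ell2_ext => z; rewrite !truncateE.
  by case: (_ \in F); rewrite ?mul1r ?mul0r.
have := ip_ge0 (f - truncate f).
have -> : ip (truncate f) (truncate f) = ip f (truncate f) by rewrite truncate_adj RR.
rewrite !ipE (ipC (truncate f) f) truncate_adj RR; lra.
Qed.

Lemma truncate_equivariant : equivariant truncate.
Proof. by move=> v f; apply: ell2_ext => -[j x]; rewrite translateE !truncateE. Qed.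

Lemma truncate_group_unit j : j \notin F -> truncate (group_unit R H j) = 0.
Proof.
move=> jF; apply: ell2_ext => -[k x]; rewrite truncateE deltaE xpair_eqE /=.
by case: (eqVneq k j) => [->|]; rewrite ?(negbTE jF) ?mul0r ?mulr0.
Qed.
End Restriction.

Section Compression.
Variables (R : realType) (G U : groupType) (X : choiceType) (d : nat).
Local Notation J := ('I_d * bool)%type.
Variables (W : seq G) (c : J -> J -> G -> R).
Variables (lact : G -> X -> X) (ract : X -> U -> X).
Hypotheses (lactP : left_action lact) (lact_free : forall g x, lact g x = x -> g = 1%g).
Hypotheses (ractP : right_action ract) (ract_free : forall x u, ract x u = x -> u = 1%g).
Hypothesis comm : forall g x u, lact g (ract x u) = ract (lact g x) u.
Variables (A : set X) (N : nat) (r : 'I_N -> X).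
Hypotheses (A_inv : forall x u, A x -> A (ract x u))
  (rP : orbit_representatives ract A r).
Local Notation K := ('I_N * 'I_d * bool)%type.
Local Notation B := (@conv_op R G J W c X lact lactP).
Local Notation BG := (@conv_op R G J W c G _ (mul_left_action G)).

Lemma ractK x u : ract (ract x u) u^-1 = x.
Proof. by case: ractP => r1 rM; rewrite -rM mulgV r1. Qed.

Lemma A_inv_iff x u : A (ract x u) <-> A x.
Proof. by split=> [/(@A_inv _ u^-1)|]; [rewrite ractK|exact: A_inv]. Qed.

Lemma range_ract x u : range (ract (ract x u)) = range (ract x).
Proof.
case: ractP => r1 rM; apply/seteqP; split=> _ [v _ <-].
  by exists (u * v)%g => //; rewrite rM.
by exists (u^-1 * v)%g => //; rewrite -rM mulgA mulgV mul1g.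
Qed.

Lemma ract_inj x u v : ract x u = ract x v -> u = v.
Proof.
case: ractP => r1 rM e.
have : ract x (u * v^-1)%g = x by rewrite rM e ractK.
move/ract_free => e1; by rewrite -[u](mulgVK v) e1 mul1g.
Qed.

(** The free orbits identify [A * ('I_d * bool)] with [U] times a finite set:
    the coordinates [a], [k], [b] stand for the representative, the matrix
    index, and the real or imaginary part. *)
Definition coords (z : K * U) : J * X :=
  ((z.1.1.2, z.1.2), ract (r z.1.1.1) z.2).

Lemma coords_inj : injective coords.
Proof.
case: rP => _ rinj _.
move=> [[[a k] b] u] [[[a' k'] b'] u'] [-> -> /= e].
have aa : a = a'.
  by apply: rinj; rewrite -(range_ract (r a) u) e range_ract.
by rewrite aa in e *; rewrite (ract_inj e).
Qed.

Lemma coords_in k b x : A x ->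
  exists a u, x = ract (r a) u /\ ((k, b), x) = coords (((a, k), b), u).
Proof.
by case: rP => _ _ rex /rex[a [u ->]]; exists a, u.
Qed.

Lemma coords_A z : A (coords z).2.
Proof. by case: rP => rA _ _; apply: A_inv; exact: rA. Qed.

Definition coords_pull : ell2 R (J * X)%type -> ell2 R (K * U)%type := pull coords_inj.
Definition coords_push : ell2 R (K * U)%type -> ell2 R (J * X)%type := push coords_inj.

Lemma coords_push_in f z : coords_push f (coords z) = f z.
Proof. exact: (extend0_in coords_inj f z). Qed.

Lemma coords_push_out f j x : ~ A x -> coords_push f (j, x) = 0.
Proof.
move=> nA; apply: extend0_out => -[z /(congr1 snd) /= e]; apply: nA; rewrite -e.
exact: (coords_A z).
Qed.

Lemma coords_pushK f j x : A x -> coords_push (coords_pull f) (j, x) = f (j, x).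
Proof.
case: j => k b /(coords_in k b)[a [u [_ ->]]]; by rewrite coords_push_in.
Qed.

Lemma coords_push_translate f v j x :
  coords_push (translate v f) (j, x) = coords_push f (j, ract x v).
Proof.
case: (pselect (A x)) => [Ax|nA]; last first.
  by rewrite !coords_push_out // A_inv_iff.
case: j => k b; have [a [u [-> e]]] := coords_in k b Ax.
rewrite e coords_push_in translateE.
have -> : ract (ract (r a) u) v = ract (r a) (u * v)%g by case: ractP.
by rewrite -[(k, b, _)]/(coords (((a, k), b), (u * v)%g)) coords_push_in.
Qed.

(** The compression of the operator to [A], written in orbit coordinates. *)
Definition compressed_op := coords_pull \o B \o coords_push.

Lemma compressed_opE f p u :
  compressed_op f (p, u) = B (coords_push f) (coords (p, u)).
Proof. by []. Qed.

Lemma compressed_op_adj : exists S', adjoint_pair compressed_op S'.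
Proof.
have [aB _] := conv_op_adjP W c lactP.
have app : adjoint_pair coords_push coords_pull by move=> f h; exact: ip_push.
exists (coords_pull \o (conv_op_adj W c lactP \o coords_push)).
exact: adj_comp (adj_comp (adjC app) aB) app.
Qed.

Lemma compressed_op_bounded : bounded_op compressed_op.
Proof.
have [_ bB] := conv_op_adjP W c lactP.
apply: bounded_comp.
  apply: bounded_comp bB; exists 1; split=> // f; rewrite mul1r; exact: pull_contr.
by exists 1; split=> // f; rewrite mul1r push_isom.
Qed.

Lemma compressed_op_equivariant : equivariant compressed_op.
Proof.
move=> v f; apply: ell2_ext => -[p u].
rewrite translateE !compressed_opE /coords /= !conv_opE.
apply: eq_bigr => l _; apply: eq_bigr => g _.
rewrite coords_push_translate -comm; congr (_ * coords_push f (_, lact _ _)).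
by case: ractP => _ ->.
Qed.

Lemma compressed_op_kernel_closed : closed_subspace (kernel compressed_op).
Proof. by have [S' aS] := compressed_op_adj; exact: closed_kernel aS. Qed.

(** Along a free G-orbit the operator on X is the one on G. *)
Lemma orbit_inj x : injective (fun z : J * G => (z.1, lact z.2 x)).
Proof.
move=> [j g] [j' h] [-> e]; congr pair.
have : lact (h^-1 * g)%g x = x.
  by case: lactP => l1 lM; rewrite lM e -lM mulVg l1.
move/lact_free => e1; by rewrite -[g](mulVKg h) e1 mulg1.
Qed.

(** Pullback along the orbit map [g |-> g x] sends the kernel over [X] to the
    kernel over [G], and the push sends it back, both being contractions;
    [proj_mono] in the two directions gives equality. *)
Lemma proj_orbit j x :
  ip (proj (kernel B) (delta R (j, x))) (delta R (j, x)) =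
  ip (proj (kernel BG) (group_unit R G j)) (group_unit R G j).
Proof.
have [aB _] := conv_op_adjP W c lactP.
have [aG _] := conv_op_adjP W c (mul_left_action G).
have [l1 lM] := lactP.
have unit1 : (fun z : J * G => (z.1, lact z.2 x)) (j, 1%g) = (j, x) by rewrite /= l1.
apply/eqP; rewrite eq_le; apply/andP; split.
- apply: (@proj_mono R _ _ _ _ (pull (@orbit_inj x))).
  + exact: closed_kernel aB.
  + exact: closed_kernel aG.
  + move=> f Bf; apply: ell2_ext => -[k g]; rewrite conv_opE.
    transitivity (B f (k, lact g x)); last by rewrite Bf.
    rewrite conv_opE; apply: eq_bigr => l _; apply: eq_bigr => h _.
    by rewrite pullE /= lM.
  + exact: pull_contr.
  + by move=> f; rewrite !ip_delta pullE unit1.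
- apply: (@proj_mono R _ _ _ _ (push (@orbit_inj x))).
  + exact: closed_kernel aG.
  + exact: closed_kernel aB.
  + move=> f Bf; apply: ell2_ext => -[k y]; rewrite conv_opE.
    case: (pselect (exists g, y = lact g x)) => [[g ->]|ny].
      transitivity (BG f (k, g)); last by rewrite Bf.
      rewrite conv_opE; apply: eq_bigr => l _; apply: eq_bigr => h _.
      rewrite -lM pushE.
      rewrite -[(l, lact _ x)]/((fun z : J * G => (z.1, lact z.2 x)) (l, (h^-1 * g)%g)).
      by rewrite (extend0_in (@orbit_inj x)).
    rewrite big1 // => l _; rewrite big1 // => h _.
    rewrite pushE extend0_out ?mulr0 // => -[[l' g] /= [_ e]]; apply: ny.
    by exists (h * g)%g; rewrite lM e actK.
  + by move=> f; rewrite push_isom.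
  + move=> f; rewrite !ip_delta -unit1 pushE.
    by rewrite (extend0_in (@orbit_inj x)).
Qed.

Lemma sum_proj_orbit :
  \sum_(p : K) ip (proj (kernel B) (delta R (coords (p, 1%g))))
    (delta R (coords (p, 1%g))) = N%:R * real_dim (kernel BG).
Proof.
under eq_bigr do rewrite proj_orbit.
pose D k b := ip (proj (kernel BG) (group_unit R G (k, b))) (group_unit R G (k, b)).
rewrite -(pair_bigA _ (fun q b => D q.2 b)) /=.
rewrite -(pair_bigA _ (fun a k => \sum_b D k b)) /=.
rewrite sumr_const card_ord mulr_natl; congr (_ *+ _).
rewrite (pair_bigA _ D) /=.
by apply: eq_bigr => -[k b] _.
Qed.

(** The boundary coordinates of the two comparisons: at [exits] the support
    of the operator moves the representative out of [A], so a vector living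
    there is seen by the operator outside [A]; at [exits_inv] the value of the
    operator depends on coordinates outside [A]. *)
Definition exits : {pred K} :=
  [pred p : K | `[< exists2 g, g \in W & ~ A (lact g (r p.1.1)) >]].
Definition exits_inv : {pred K} :=
  [pred p : K | `[< exists2 g, g \in W & ~ A (lact g^-1 (r p.1.1)) >]].

Lemma exitsP p : reflect (exists2 g, g \in W & ~ A (lact g (r p.1.1))) (p \in exits).
Proof. exact: asboolP. Qed.
Lemma exits_invP p : reflect (exists2 g, g \in W & ~ A (lact g^-1 (r p.1.1))) (p \in exits_inv).
Proof. exact: asboolP. Qed.

(** The vectors of the compressed kernel that vanish on [exits] extend by zero
    to the kernel on the whole space; imposing this vanishing costs
    [#|exits|]. *)
Lemma real_dim_compressed_le :
  real_dim (kernel compressed_op) <= N%:R * real_dim (kernel BG) + #|exits|%:R.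
Proof.
have [S' aS] := compressed_op_adj.
have [aB _] := conv_op_adjP W c lactP.
have cK := compressed_op_kernel_closed.
have iK := invariant_kernel compressed_op_equivariant.
apply: le_trans (real_dim_kernel cK iK (@truncate_adj R K U exits)
  (@truncate_bounded R K U exits) (@truncate_equivariant R K U exits)
  (@truncate_group_unit R K U exits)) _.
rewrite lerD2r -sum_proj_orbit; apply: ler_sum => p _.
apply: (@proj_mono R _ _ _ _ coords_push).
- by apply: closed_subspaceI => //; exact: closed_kernel (@truncate_adj R K U exits).
- exact: closed_kernel aB.
- move=> f [Tf Rf]; apply: ell2_ext => -[[k b] x].
  case: (pselect (A x)) => [/(coords_in k b)[a [u [_ ->]]]|nA].
    by rewrite -compressed_opE Tf.
  rewrite conv_opE big1 // => -[l e] _; rewrite big_seq big1 // => g gW.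
  case: (pselect (A (lact g^-1 x))) => [Ax|nA']; last by rewrite coords_push_out ?mulr0.
  have [a [u [ex ->]]] := coords_in l e Ax.
  rewrite coords_push_in.
  have : truncate exits f ((a, l, e), u) = 0 by rewrite Rf.
  rewrite truncateE /=.
  have -> : (a, l, e) \in exits.
    apply/exitsP; exists g => // Ag; apply: nA.
    rewrite -(actK lactP g x) ex comm; exact: A_inv.
  by rewrite mul1r => ->; rewrite mulr0.
- by move=> f; rewrite push_isom.
- by move=> f; rewrite !ip_delta coords_push_in.
Qed.

(** [L] is the closed span of the restrictions to [A] of the kernel on the
    whole space. The compression kills [L] except on [exits_inv], so after
    imposing [#|exits_inv|] conditions [L] lies in the compressed kernel. *)
Lemma real_dim_compressed_ge :
  N%:R * real_dim (kernel BG) <= real_dim (kernel compressed_op) + #|exits_inv|%:R.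
Proof.
have [S' aS] := compressed_op_adj.
have [aB _] := conv_op_adjP W c lactP.
pose L := annihilator (annihilator (coords_pull @` kernel B)).
have cL : closed_subspace L by eexists.
have LK f : kernel B f -> L (coords_pull f).
  by move=> Kf w Aw; rewrite ipC; apply: Aw; exists f.
have annI W' : invariant W' -> invariant (annihilator W').
  move=> iW v f fW w Ww; rewrite (translate_adj v); apply: fW; exact: iW.
have iL : invariant L.
  apply/annI/annI => v _ [f Bf <-].
  have inj : injective (fun z : J * X => (z.1, ract z.2 v)).
    by move=> [j x] [k y] [-> e]; rewrite -(ractK x v) e ractK.
  exists (pull inj f).
    apply: ell2_ext => -[j x]; rewrite conv_opE.
    transitivity (B f (j, ract x v)); last by rewrite Bf.
    rewrite conv_opE; apply: eq_bigr => l _; apply: eq_bigr => g _.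
    by rewrite pullE /= comm.
  apply: ell2_ext => -[p u]; rewrite translateE.
  rewrite -[LHS]/(f ((p.1.2, p.2), ract (ract (r p.1.1) u) v)).
  rewrite -[RHS]/(f ((p.1.2, p.2), ract (r p.1.1) (u * v)%g)).
  by case: ractP => _ ->.
pose T := @truncate R K U exits_inv \o compressed_op.
have aT : adjoint_pair T (S' \o @truncate R K U exits_inv).
  by apply: adj_comp aS; exact: truncate_adj.
have bT : bounded_op T.
  by apply: bounded_comp compressed_op_bounded; exact: truncate_bounded.
have eT : equivariant T.
  by move=> v f; rewrite /T /= compressed_op_equivariant truncate_equivariant.
have TF j : j \notin exits_inv -> (S' \o @truncate R K U exits_inv) (group_unit R U j) = 0.
  by move=> jF; rewrite /= truncate_group_unit // (adj0 (adjC aS)).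
have dim := real_dim_kernel cL iL aT bT eT TF.
have step1 : N%:R * real_dim (kernel BG) <= real_dim L.
  rewrite -sum_proj_orbit; apply: ler_sum => p _.
  apply: (@proj_mono R _ _ _ _ coords_pull) => //.
  - exact: closed_kernel aB.
  - by move=> f; exact: pull_contr.
  - by move=> f; rewrite !ip_delta.
apply: le_trans step1 (le_trans dim _).
rewrite lerD2r; apply: ler_sum => p _.
apply: (@proj_mono R _ _ _ _ id) => //.
- by apply: closed_subspaceI => //; exact: closed_kernel aT.
- exact: closed_kernel aS.
move=> f [Lf Tf]; apply: ell2_ext => -[q u].
case: (boolP (q \in exits_inv)) => [qF|qF].
  have : truncate exits_inv (compressed_op f) (q, u) = 0 by rewrite -[truncate _ _]/(T f) Tf.
  by rewrite truncateE qF mul1r.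
(* Off [exits_inv] the vanishing of [compressed_op f] is a condition of
   orthogonality, so it suffices to check it on the generators of [L]. *)
rewrite -ip_delta aS; apply: Lf => _ [k Bk <-].
rewrite (adjC aS) ipC ip_delta compressed_opE.
transitivity (B k (coords (q, u))); last by rewrite Bk.
rewrite !conv_opE; apply: eq_bigr => l _; rewrite big_seq [RHS]big_seq.
apply: eq_bigr => g gW; rewrite coords_pushK //.
rewrite comm; apply: A_inv; apply: contrapT => nA.
by move/negP: qF; apply; apply/exits_invP; exists g.
Qed.

End Compression.

(** * Counting boundary orbits *)

Lemma pred_asboolP (T : Type) (Q : T -> Prop) a :
  reflect (Q a) (a \in [pred a | `[< Q a >]]).
Proof. exact: asboolP. Qed.

Lemma card_pred_or (T : finType) (Q Q1 Q2 : T -> Prop) :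
  (forall a, Q a -> Q1 a \/ Q2 a) ->
  (#|[pred a | `[< Q a >]]| <= #|[pred a | `[< Q1 a >]]| + #|[pred a | `[< Q2 a >]]|)%N.
Proof.
move=> H; rewrite -!sum1_card [leqLHS]big_mkcond.
rewrite [X in (_ <= X + _)%N]big_mkcond [X in (_ <= _ + X)%N]big_mkcond.
rewrite -big_split /=; apply: leq_sum => a _.
case: (pred_asboolP Q a) => [/H|_]; last by [].
by case: (pred_asboolP Q1 a); case: (pred_asboolP Q2 a) => // n1 n2 [].
Qed.

Lemma card_pred_false (T : finType) (Q : T -> Prop) :
  (forall a, ~ Q a) -> #|[pred a | `[< Q a >]]| = 0%N.
Proof.
by move=> H; apply: eq_card0 => a; apply/negbTE/negP => /pred_asboolP; exact: H.
Qed.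

Section BoundaryCount.
Variables (R : realType) (G U : groupType) (S : set G) (X : choiceType).
Variables (lact : G -> X -> X) (ract : X -> U -> X) (Xs : nat -> set X).
Hypothesis HX : gen_amenable_extension R S lact ract Xs.
Variable (r : forall i : nat, 'I_(norbits ract (Xs i)) -> X).
Arguments r : clear implicits.
Hypothesis Hr : forall i : nat, orbit_representatives ract (Xs i) (r i).

Definition frontier i : set X := [set lact s x | s in S & x in Xs i] `\` Xs i.

Lemma frontier_finite i : finite_set (orbits ract (frontier i)).
Proof.
have fS := gens_finite HX; have fA := exhaustion_finite HX i.
apply: (@sub_finite_set _ _ ((fun p : G * set X => lact p.1 @` p.2) @`
   (S `*` orbits ract (Xs i)))); last first.
  by apply: finite_image; exact: finite_setX.
move=> _ [_ [[s Ss [x Ax <-]] _] <-].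
exists (s, range (ract x)); first by split=> //; exists x.
apply/seteqP; split=> [_ [_ [u _ <-] <-]|_ [u _ <-]] /=.
  by exists u => //; rewrite (actions_commute HX).
by exists (ract x u); [exists u|rewrite (actions_commute HX)].
Qed.

(** Left translation by [h] permutes the [U]-orbits, so distinct
    representatives land in distinct orbits. *)
Lemma count_orbits i (D : set X) h : finite_set (orbits ract D) ->
  (#|[pred a | `[< D (lact h (r i a)) >]]| <= norbits ract D)%N.
Proof.
move=> fD; rewrite /norbits cardE.
have [_ rinj _] := Hr i.
have inj : injective (fun a => range (ract (lact h (r i a)))).
  move=> a b e; apply: rinj.
  have act_h x : range (ract x) = lact h^-1 @` range (ract (lact h x)).
    apply/seteqP; split=> [_ [u _ <-]|_ [_ [u _ <-] <-]] /=.
      exists (ract (lact h x) u); first by exists u.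
      by rewrite -(actions_commute HX) (actVK (lact_action HX)).
    exists u => //.
    by rewrite -(actions_commute HX) (actVK (lact_action HX)).
  by rewrite act_h e -act_h.
rewrite -(size_map (fun a => range (ract (lact h (r i a))))).
apply: uniq_leq_size; first by rewrite map_inj_uniq // enum_uniq.
move=> _ /mapP[a + ->]; rewrite mem_enum => /pred_asboolP Da.
by rewrite in_fset_set // inE; exists (lact h (r i a)).
Qed.

(** Apply the letters of the word one after another: a point that ends outside
    [Xs i] passes from [Xs i] into the frontier at some step, and each of the
    steps accounts for at most one representative per frontier orbit. *)
Lemma word_exit_count i (w : seq G) : (forall h, h \in w -> S h) ->
  (#|[pred a | `[< ~ Xs i (lact (\prod_(h <- w) h)%g (r i a)) >]]|
     <= size w * norbits ract (frontier i))%N.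
Proof.
elim: w => [|s w IH] wS.
  rewrite big_nil mul0n card_pred_false // => a; apply.
  by have [l1 _] := lact_action HX; have [rA _ _] := Hr i; rewrite l1.
rewrite big_cons /= mulSn addnC.
set g := (\prod_(h <- w) h)%g.
apply: leq_trans (@card_pred_or _ _ (fun a => ~ Xs i (lact g (r i a)))
  (fun a => frontier i (lact (s * g)%g (r i a))) _) _.
  move=> a na; case: (pselect (Xs i (lact g (r i a)))) => [Xg|nX]; last by left.
  right; split=> //; exists s; first by apply: wS; rewrite mem_head.
  by exists (lact g (r i a)) => //; have [_ ->] := lact_action HX.
apply: leq_add.
  by apply: IH => h hw; apply: wS; rewrite inE hw orbT.
exact: count_orbits (frontier_finite i).
Qed.

Lemma exit_count (W : seq G) : exists C, forall i,
  (#|[pred a | `[< exists2 g, g \in W & ~ Xs i (lact g (r i a)) >]]|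
     <= C * norbits ract (frontier i))%N.
Proof.
elim: W => [|g W [C HC]].
  by exists 0%N => i; rewrite card_pred_false // => a [].
have [w [wS ->]] := gens_generate HX g; set h := (\prod_(h <- w) h)%g.
exists (size w + C)%N => i; rewrite mulnDl.
apply: leq_trans (@card_pred_or _ _ (fun a => ~ Xs i (lact h (r i a)))
  (fun a => exists2 g, g \in W & ~ Xs i (lact g (r i a))) _) _.
  by move=> a [g']; rewrite in_cons => /orP[/eqP ->|gW] nX; [left|right; exists g'].
apply: leq_add => //.
exact: word_exit_count.
Qed.

Lemma norbits_gt0 : \forall i \near \oo, (0 < norbits ract (Xs i))%N.
Proof.
have [x _] := space_nonempty HX.
have : (\bigcup_k Xs k) x by rewrite (exhaustion_covers HX).
move=> [k _ kx]; exists k => // i /= ki.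
have ix : Xs i x.
  elim: i ki => [|i IH]; first by rewrite leqn0 => /eqP <-.
  rewrite leq_eqVlt => /orP[/eqP <- //|/IH]; exact: (exhaustion_increasing HX).
have [_ _ /(_ _ ix)[a _]] := Hr i.
exact: leq_ltn_trans (leq0n a) (ltn_ord a).
Qed.

Lemma exit_ratio (W : seq G) :
  #|[pred a | `[< exists2 g, g \in W & ~ Xs i (lact g (r i a)) >]]|%:R
    / (norbits ract (Xs i))%:R @[i --> \oo] --> (0 : R).
Proof.
have [C HC] := exit_count W.
have fol := exhaustion_foelner HX.
apply: (@squeeze_cvgr _ _ _ _ (fun=> 0)
  (fun i => C%:R * ((norbits ract (frontier i))%:R / (norbits ract (Xs i))%:R))).
- near=> i; rewrite divr_ge0 //= mulrA ler_wpM2r ?invr_ge0 //.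
  by rewrite -natrM ler_nat.
- exact: cvg_cst.
- rewrite -(mulr0 (C%:R : R)); apply: cvgM; [exact: cvg_cst|exact: fol].
Unshelve. all: by end_near.
Qed.

End BoundaryCount.

(** * Complex families as real families *)

Lemma Complex_sum (R : realType) (I : Type) (s : seq I) (a b : I -> R) :
  \sum_(i <- s) Complex (a i) (b i) = Complex (\sum_(i <- s) a i) (\sum_(i <- s) b i).
Proof. by elim: s => [|i s IH]; rewrite ?big_nil // !big_cons IH. Qed.

Lemma Complex_eta (R : realType) (z : R[i]) : z = Complex (complex.Re z) (complex.Im z).
Proof. by case: z. Qed.

Lemma Complex_inj (R : realType) (z w : R[i]) :
  complex.Re z = complex.Re w -> complex.Im z = complex.Im w -> z = w.
Proof. by case: z => a b; case: w => c d /= -> ->. Qed.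

Lemma sum_pair_bool (R : realType) (I : finType) (F : I * bool -> R) :
  \sum_j F j = \sum_i (F (i, false) + F (i, true)).
Proof.
transitivity (\sum_i \sum_b F (i, b)).
  by rewrite pair_bigA /=; apply: eq_bigr => -[].
by apply: eq_bigr => i _; rewrite big_bool addrC.
Qed.

Section RealForm.
Variables (R : realType) (I : finType) (T : choiceType).
Local Notation E := (ell2 R ((I * bool) * T)%type).
Implicit Types (g h k : E).

(** The boolean coordinate is [false] for real parts and [true] for imaginary
    parts. *)
Definition complex_fun (g : (I * bool) * T -> R) : I -> T -> R[i] :=
  fun i t => Complex (g ((i, false), t)) (g ((i, true), t)).

Definition real_fun (f : I -> T -> R[i]) (z : (I * bool) * T) : R :=
  if z.1.2 then complex.Im (f z.1.1 z.2) else complex.Re (f z.1.1 z.2).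

Lemma real_funK f : complex_fun (real_fun f) = f.
Proof. by apply/funext => i; apply/funext => t; rewrite /complex_fun /real_fun /= -Complex_eta. Qed.

Lemma normc_sq (z : R[i]) : Normc.normc z ^+ 2 = complex.Re z ^+ 2 + complex.Im z ^+ 2.
Proof. by case: z => a b /=; rewrite sqr_sqrtr // addr_ge0 // sqr_ge0. Qed.

Lemma l2_finite_sum (f : I -> T -> R[i]) :
  l2 f <-> forall i, finite_sum (fun t => complex.Re (f i t) ^+ 2 + complex.Im (f i t) ^+ 2).
Proof.
have E i : square_summable (f i) =
    finite_sum (fun t => complex.Re (f i t) ^+ 2 + complex.Im (f i t) ^+ 2).
  by congr (_ < _)%E; apply: eq_esum => t _; rewrite normc_sq.
by split=> H i; have := H i; rewrite E.
Qed.

Lemma l2_complex_fun g : l2 (complex_fun g).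
Proof.
apply/l2_finite_sum => i /=.
have H j := @finite_sum_slice R _ T (fun z => g z ^+ 2) j (fun z => sqr_ge0 (g z)) (ell2P g).
by apply: finite_sumD (H (i, false)) (H (i, true)) => t; exact: sqr_ge0.
Qed.

Lemma l2_real_fun f : l2 f -> finite_sum (fun z => real_fun f z ^+ 2).
Proof.
move/l2_finite_sum => H; apply: (tsum_slice _ _).1 => [z|[i b]]; first exact: sqr_ge0.
apply: finite_sum_le (H i) => t; rewrite /real_fun /=.
by case: b; rewrite ?lerDl ?lerDr sqr_ge0.
Qed.

Lemma l2_ex f : l2 f -> exists g : E, f = complex_fun g.
Proof. by move=> /l2_real_fun H; exists (mk_ell2 H); rewrite -[LHS]real_funK. Qed.

(** Multiplication by the imaginary unit ([complex_fun_rot]). *)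
Definition rot_fun (g : (I * bool) * T -> R) (z : (I * bool) * T) : R :=
  if z.1.2 then g ((z.1.1, false), z.2) else - g ((z.1.1, true), z.2).

Lemma complex_fun_rot (g : (I * bool) * T -> R) :
  complex_fun (rot_fun g) = (fun i t => Complex 0 1 * complex_fun g i t).
Proof.
apply/funext => i; apply/funext => t; rewrite /complex_fun /rot_fun /=.
by apply: Complex_inj => /=; rewrite ?mul0r ?mul1r ?sub0r ?add0r ?addr0.
Qed.

Lemma rot_finite_sum g : finite_sum (fun z => rot_fun g z ^+ 2).
Proof.
have H j := @finite_sum_slice R _ T (fun z => g z ^+ 2) j (fun z => sqr_ge0 (g z)) (ell2P g).
apply: (tsum_slice _ _).1 => [z|[i b]]; first exact: sqr_ge0.
rewrite /rot_fun /=; case: b; first exact: (H (i, false)).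
by under eq_fun do rewrite sqrrN; exact: (H (i, true)).
Qed.

Definition rot g : E := mk_ell2 (rot_finite_sum g).

Lemma ip_slice g h : ip g h =
  \sum_i (rsum (fun t => g ((i, false), t) * h ((i, false), t))
    + rsum (fun t => g ((i, true), t) * h ((i, true), t))).
Proof.
rewrite /ip rsum_slice; last exact: ip_abs_summable.
exact: sum_pair_bool.
Qed.

Lemma abs_summable_slice (a : (I * bool) * T -> R) j :
  abs_summable a -> abs_summable (fun t => a (j, t)).
Proof. by move=> ha; exact: (finite_sum_slice j (fun z => normr_ge0 (a z)) ha). Qed.

Lemma Re_inner g h : complex.Re (inner (complex_fun g) (complex_fun h)) = ip g h.
Proof.
rewrite /inner /csum Complex_sum /= ip_slice; apply: eq_bigr => i _.
rewrite -rsumD; [|exact: (abs_summable_slice _ (ip_abs_summable g h))..].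
by congr rsum; apply/funext => t; rewrite /= mulrN opprK.
Qed.

Lemma rot_isom g : ip (rot g) (rot g) = ip g g.
Proof.
rewrite !ip_slice; apply: eq_bigr => i _; rewrite addrC; congr (_ + _).
by congr rsum; apply/funext => t; rewrite /= /rot_fun /= mulrNN.
Qed.

(** Real parts determine the complex inner product, by letting the second
    argument rotate. *)
Lemma inner_rot (f h : I -> T -> R[i]) :
  complex.Im (inner f h) = complex.Re (inner f (fun i t => Complex 0 1 * h i t)).
Proof.
rewrite /inner /csum !Complex_sum /=; apply: eq_bigr => i _.
congr rsum; apply/funext => t; case: (f i t) => a b; case: (h i t) => c e /=; ring.
Qed.

Section Subspace.
Variables (K : set (I -> T -> R[i])) (M : set E).
Hypotheses (cM : closed_subspace M) (Ml2 : forall f, K f -> l2 f)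
  (KM : forall g, K (complex_fun g) <-> M g) (Mrot : forall g, M g -> M (rot g)).

(** For a subspace stable under the imaginary unit, orthogonality for the real
    and for the complex inner product agree, hence so do the projections. *)
Lemma orth_proj_complex_fun g : orth_proj K (complex_fun g) = complex_fun (proj M g).
Proof.
have sub g1 g2 : complex_fun g1 - complex_fun g2 = complex_fun (g1 - g2).
  by apply/funext => i; apply/funext => t.
rewrite /orth_proj; case: xgetP => [h _ [Kh hP]|].
  have [h' eh] := l2_ex (Ml2 Kh); rewrite eh in Kh hP *.
  rewrite (proj_uniq cM (h := h')) //; first exact/KM.
  by move=> k /KM Kk; rewrite -Re_inner -sub hP.
move=> /(_ (complex_fun (proj M g))) []; split; first exact: (KM _).2 (proj_in cM g).
move=> k Kk; have [k' ek] := l2_ex (Ml2 Kk); rewrite ek in Kk *.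
have Mk : M k' by exact/KM.
have H k0 : M k0 -> complex.Re (inner (complex_fun g - complex_fun (proj M g)) (complex_fun k0)) = 0.
  by move=> M0; rewrite sub Re_inner (projP cM g).2.
apply: Complex_inj; first exact: H.
by rewrite inner_rot -complex_fun_rot; exact: (H (rot k') (Mrot Mk)).
Qed.
End Subspace.
End RealForm.

(** Each complex basis vector gives the two real ones [e] and [i e], at which
    the projection has equal diagonal coefficients since it commutes with
    rotation; whence the factor 2. *)
Lemma vn_dimE (R : realType) (I : finType) (H : groupType)
    (K : set (I -> H -> R[i])) (M : set (ell2 R ((I * bool) * H)%type)) :
  closed_subspace M -> (forall f, K f -> l2 f) ->
  (forall g : ell2 R ((I * bool) * H)%type, K (complex_fun g) <-> M g) ->
  (forall g, M g -> M (rot g)) -> vn_dim K = real_dim M / 2.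
Proof.
move=> cM Ml2 KM Mrot.
have unitE i : @unit_vec R H I i = complex_fun (group_unit R H (i, false)).
  apply/funext => j; apply/funext => x; apply: Complex_inj => /=.
    by rewrite /unit_vec !xpair_eqE eqxx andbT; case: ((j == i) && _).
  by rewrite /unit_vec !xpair_eqE /= andbF /=; case: ((j == i) && _).
have -> : vn_dim K =
    \sum_i ip (proj M (group_unit R H (i, false))) (group_unit R H (i, false)).
  rewrite /vn_dim /vn_trace.
  under eq_bigr => i _ do rewrite unitE
    (orth_proj_complex_fun cM Ml2 KM Mrot) (Complex_eta (inner _ _)) Re_inner.
  by rewrite Complex_sum.
have <- : \sum_i (ip (proj M (group_unit R H (i, false)))
    (group_unit R H (i, false)) * 2) = real_dim M.
  rewrite /real_dim sum_pair_bool; apply: eq_bigr => i _.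
  rewrite mulr_natr mulr2n; congr (_ + _); apply/eqP.
  rewrite eq_le; apply/andP; split.
    apply: (@proj_mono R _ _ M M (@rot R I H)) => //.
    - by move=> f; rewrite rot_isom.
    - by move=> f; rewrite !ip_delta.
  apply: (@proj_mono R _ _ M M (fun f => - rot f)) => //.
  - by move=> f Mf; rewrite -scaleN1r; apply: closed_subspaceZ => //; exact: Mrot.
  - by move=> f; rewrite ipNl ipNr opprK rot_isom.
  - by move=> f; rewrite ipNl !ip_delta /= /rot_fun /= opprK.
by rewrite -mulr_suml mulfK.
Qed.

(** * The complex operators in real form *)

Section ComplexOperators.
Variables (R : realType) (G : groupType) (d : nat).
Variable Bm : 'M[group_ring R G]_d.
Local Notation J := ('I_d * bool)%type.

(** One list containing the supports of all entries, without repetitions so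
    that sums over it agree with sums over each support. *)
Definition supp_seq : seq G :=
  undup (flatten [seq (finsupp (Bm p.1 p.2) : seq G) | p <- enum {: 'I_d * 'I_d}]).

Lemma sum_supp_seq k l (F : G -> R[i]) :
  \sum_(g <- finsupp (Bm k l)) Bm k l g * F g = \sum_(g <- supp_seq) Bm k l g * F g.
Proof.
rewrite [RHS](bigID (mem (finsupp (Bm k l)))) /= [X in _ + X]big1 ?addr0; last first.
  by move=> g gB; rewrite fsfun_dflt ?mul0r.
rewrite -[RHS]big_filter; apply: perm_big; apply: uniq_perm.
- exact: fset_uniq.
- by rewrite filter_uniq // undup_uniq.
move=> g; rewrite mem_filter; case E : (g \in finsupp _) => //=; symmetry.
rewrite mem_undup; apply/flattenP; exists (enum_fset (finsupp (Bm k l))) => //.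
by apply/mapP; exists (k, l); rewrite ?mem_enum.
Qed.

(** The 2 x 2 real matrix of multiplication by the complex coefficient. *)
Definition real_coef (j l : J) (g : G) : R :=
  let z := Bm j.1 l.1 g in
  match j.2, l.2 with
  | false, false => complex.Re z
  | false, true => - complex.Im z
  | true, false => complex.Im z
  | true, true => complex.Re z
  end.

Section OnSpace.
Variables (X : choiceType) (act : G -> X -> X) (actP : left_action act).
Local Notation B := (conv_op supp_seq real_coef actP).

Lemma mx_operator_complex_fun (f : ell2 R (J * X)%type) :
  mx_operator Bm act (complex_fun f) = complex_fun (B f).
Proof.
apply/funext => k; apply/funext => x.
rewrite /mx_operator /complex_fun !conv_opE !sum_pair_bool.
rewrite -Complex_sum; apply: eq_bigr => l _.
rewrite sum_supp_seq -!big_split -Complex_sum; apply: eq_bigr => g _.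
rewrite /real_coef /=; case: (Bm k l g) => a b.
by apply: Complex_inj => /=; ring.
Qed.

Lemma mx_operator_i (f : 'I_d -> X -> R[i]) :
  mx_operator Bm act (fun l x => Complex 0 1 * f l x) =
  (fun k x => Complex 0 1 * mx_operator Bm act f k x).
Proof.
apply/funext => k; apply/funext => x; rewrite /mx_operator mulr_sumr.
apply: eq_bigr => l _; rewrite mulr_sumr; apply: eq_bigr => g _.
by rewrite mulrCA.
Qed.

Lemma complex_fun_eq0 (f : ell2 R (J * X)%type) : complex_fun f = 0 <-> f = 0.
Proof.
split=> [H|->]; last by apply/funext => k; apply/funext => x.
apply: ell2_ext => -[[k b] x].
have := congr1 (fun h : 'I_d -> X -> R[i] => h k x) H.
by case: b => -[].
Qed.
End OnSpace.

Lemma vn_dim_conv : vn_dim (l2ker (conv_operator Bm)) =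
  real_dim (kernel (conv_op supp_seq real_coef (mul_left_action G))) / 2.
Proof.
have [aG _] := conv_op_adjP supp_seq real_coef (mul_left_action G).
have KM (g : ell2 R (J * G)%type) : l2ker (conv_operator Bm) (complex_fun g) <->
    kernel (conv_op supp_seq real_coef (mul_left_action G)) g.
  have E := mx_operator_complex_fun (mul_left_action G) g.
  split=> [[_ H]|H]; first by apply/complex_fun_eq0; rewrite -E.
  by split; [exact: l2_complex_fun|rewrite /conv_operator E; exact/complex_fun_eq0].
apply: vn_dimE => //; first exact: closed_kernel aG.
- by move=> f [].
- move=> g Mg; apply/KM; split; first exact: l2_complex_fun.
  rewrite complex_fun_rot /conv_operator mx_operator_i.
  have /KM[_ H] := Mg.
  apply/funext => k; apply/funext => x.
  have := congr1 (fun h : 'I_d -> G -> R[i] => h k x) H.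
  by rewrite /conv_operator => ->; rewrite mulr0.
Qed.

Section Compressed.
Variables (U : groupType) (X : choiceType).
Variables (lact : G -> X -> X) (ract : X -> U -> X).
Hypotheses (lactP : left_action lact).
Hypotheses (ractP : right_action ract) (ract_free : forall x u, ract x u = x -> u = 1%g).
Variables (A : set X) (N : nat) (r : 'I_N -> X).
Hypotheses (A_inv : forall x u, A x -> A (ract x u))
  (rP : orbit_representatives ract A r).
Local Notation K := ('I_N * 'I_d * bool)%type.
Local Notation T := (@compressed_op R G U X d supp_seq real_coef lact ract
  lactP ractP ract_free A N r rP).
Local Notation ext := (@coords_push R U X d ract ractP ract_free A N r rP).

Lemma inclusion_in (f : 'I_d -> X -> R[i]) k x : A x ->
  inclusion (restriction (A := A) f) k x = f k x.
Proof.
move=> Ax; rewrite /inclusion /restriction.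
have := congr1 (fun F => F (f k) x) (sigLK (0 : R[i]) (A := A)).
by rewrite /= => ->; rewrite /patch mem_set.
Qed.

Lemma inclusion_out (f : 'I_d -> A -> R[i]) k x : ~ A x -> inclusion f k x = 0.
Proof.
move=> nA; rewrite /inclusion -(valLK (0 : R[i]) (f k)).
have := congr1 (fun F => F ('valL_0 (f k)) x) (sigLK (0 : R[i]) (A := A)).
by rewrite /= => ->; rewrite /patch memNset.
Qed.

Lemma restrictionK (f : 'I_d -> A -> R[i]) : restriction (A := A) (inclusion f) = f.
Proof. by apply/funext => k; exact: valLK. Qed.

Lemma restriction_eq0 (f : 'I_d -> X -> R[i]) :
  restriction (A := A) f = 0 <-> forall k x, A x -> f k x = 0.
Proof.
split=> [H k x Ax|H].
  by rewrite -(inclusion_in f k Ax) H /inclusion /=; case: ('oinv_ _ _).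
apply/funext => k; apply/funext => -[x Ax]; apply: H; exact: set_mem.
Qed.

(** Membership in the compressed kernel, on the complex side: the extension by
    zero is sent to a vector that vanishes on [A]. *)
Lemma compressed_op_complex_fun (g : ell2 R (K * U)%type) :
  kernel T g <-> forall k x, A x -> mx_operator Bm lact (complex_fun (ext g)) k x = 0.
Proof.
split=> [Tg k x Ax|H].
  rewrite mx_operator_complex_fun /complex_fun.
  have H b : conv_op supp_seq real_coef lactP (ext g) ((k, b), x) = 0.
    have [a [u [_ ->]]] := coords_in rP k b Ax.
    by rewrite -compressed_opE Tg.
  by rewrite !H.
apply: ell2_ext => -[[[a k] b] u]; rewrite compressed_opE /coords /=.
have := H k (ract (r a) u) (coords_A A_inv rP (((a, k), b), u)).
by rewrite mx_operator_complex_fun /complex_fun => -[]; case: b.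
Qed.

Lemma orbit_coordinatesE (f : 'I_d -> A -> R[i]) (g : ell2 R (K * U)%type) :
  orbit_coordinates ract r f = complex_fun g <-> inclusion f = complex_fun (ext g).
Proof.
have ext_in b a k u : ext g ((k, b), ract (r a) u) = g (((a, k), b), u).
  by rewrite -[((k, b), _)]/(coords ract r (((a, k), b), u)) coords_push_in.
split=> [H|H].
  apply/funext => k; apply/funext => x.
  case: (pselect (A x)) => [Ax|nA]; last first.
    by rewrite inclusion_out // /complex_fun !coords_push_out.
  have [a [u [-> _]]] := coords_in rP k true Ax.
  have -> : inclusion f k (ract (r a) u) = complex_fun g (a, k) u by rewrite -H.
  by rewrite /complex_fun !ext_in.
apply/funext => -[a k]; apply/funext => u; rewrite /orbit_coordinates H.
by rewrite /complex_fun !ext_in.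
Qed.

Lemma l2_restriction (g : ell2 R (J * X)%type) : l2 (restriction (A := A) (complex_fun g)).
Proof.
apply/l2_finite_sum => i.
have /l2_finite_sum/(_ i) H := l2_complex_fun g.
have inj : injective (set_val : A -> X) by exact: val_inj.
apply: (finite_sum_comp inj _ H).1 => t; by rewrite addr_ge0 // sqr_ge0.
Qed.

Lemma l2_orbit_coordinates (f : 'I_d -> A -> R[i]) :
  l2 f -> l2 (orbit_coordinates ract r f).
Proof.
move=> /l2_finite_sum H; apply/l2_finite_sum => -[a k].
have rA u : A (ract (r a) u) by exact: (coords_A A_inv rP (((a, k), true), u)).
pose phi u : A := SigSub (mem_set (rA u)).
have inj : injective phi.
  by move=> u v [/(ract_inj ractP ract_free)].
apply: finite_sum_le (finite_sum_comp inj _ (H k)).1 => [u|t]; last first.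
  by rewrite addr_ge0 // sqr_ge0.
have -> : orbit_coordinates ract r f (a, k) u = f k (phi u).
  rewrite /orbit_coordinates /= -{2}(restrictionK f) //.
by [].
Qed.

Lemma vn_dim_compression :
  vn_dim_orbits ract r (l2ker (compression Bm lact (A := A))) = real_dim (kernel T) / 2.
Proof.
have KM (g : ell2 R (K * U)%type) :
    (orbit_coordinates ract r @` l2ker (compression Bm lact (A := A))) (complex_fun g) <->
    kernel T g.
  split=> [[f [fl2 cf] /orbit_coordinatesE fg]|Tg].
    apply/compressed_op_complex_fun; move: cf; rewrite /compression fg.
    exact: (restriction_eq0 _).1.
  exists (restriction (A := A) (complex_fun (ext g))).
    split; first exact: l2_restriction.
    rewrite /compression; apply/restriction_eq0.
    have -> : inclusion (restriction (A := A) (complex_fun (ext g))) = complex_fun (ext g).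
      apply/funext => k; apply/funext => x.
      case: (pselect (A x)) => [Ax|nA]; first exact: inclusion_in.
      by rewrite inclusion_out // /complex_fun !coords_push_out.
    exact/compressed_op_complex_fun.
  apply/orbit_coordinatesE; apply/funext => k; apply/funext => x.
  case: (pselect (A x)) => [Ax|nA]; first exact: inclusion_in.
  by rewrite inclusion_out // /complex_fun !coords_push_out.
apply: vn_dimE => //.
- exact: compressed_op_kernel_closed.
- by move=> _ [f [fl2 _] <-]; exact: l2_orbit_coordinates.
- move=> g /compressed_op_complex_fun Tg; apply/compressed_op_complex_fun => k x Ax.
  have -> : complex_fun (ext (rot g)) = (fun l y => Complex 0 1 * complex_fun (ext g) l y).
    rewrite -complex_fun_rot; congr complex_fun; apply/funext => -[[l b] y].
    transitivity (if b then ext g ((l, false), y) else - ext g ((l, true), y)).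
      2: by case: b.
    case: (pselect (A y)) => [Ay|nA]; last by rewrite !coords_push_out // oppr0; case: b.
    have [a [u [-> _]]] := coords_in rP l b Ay.
    have e b' : ((l, b'), ract (r a) u) = coords ract r (((a, l), b'), u) by [].
    by rewrite !e !coords_push_in; case: b.
  by rewrite mx_operator_i Tg // mulr0.
Qed.

End Compressed.
End ComplexOperators.

(** * The limit *)

Lemma card_first_coordinate (N d : nat) (Q : 'I_N -> Prop) (P : {pred 'I_N * 'I_d * bool}) :
  (forall p, p \in P -> Q p.1.1) ->
  (#|P| <= #|[pred a | `[< Q a >]]| * (d * 2))%N.
Proof.
move=> H.
have -> : (#|[pred a | `[< Q a >]]| * (d * 2) =
    #|[predX [predX [pred a | `[< Q a >]] & predT : pred 'I_d] & predT : pred bool]|)%N.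
  rewrite !cardX -mulnA; congr (_ * (_ * _))%N.
    by rewrite -[LHS](card_ord d); exact: eq_card.
  by rewrite -[LHS]card_bool; exact: eq_card.
apply/subset_leq_card/fintype.subsetP => -[[a k] b] /H /= Qa.
by apply/andP; split=> //; apply/andP; split=> //; apply/pred_asboolP.
Qed.

Theorem theorem3p11 (R : realType) (G : groupType)
    (P : pred G) (U : subGroupType P)
    (U_normal : forall x g : G, x \in P -> (x ^ g)%g \in P)
    (S : set G) (X : choiceType) (lact : G -> X -> X) (ract : X -> U -> X)
    (Xs : nat -> set X)
    (HX : gen_amenable_extension R S lact ract Xs)
    (r : forall i : nat, 'I_(norbits ract (Xs i)) -> X)
    (Hr : forall i : nat, orbit_representatives ract (Xs i) (r i))
    (d : nat) (B : 'M[group_ring R G]_d) :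
  vn_dim_orbits ract (r i) (l2ker (compression B lact (A := Xs i)))
    / (norbits ract (Xs i))%:R @[i --> \oo]
  --> vn_dim (l2ker (conv_operator B)).
Proof.
have lactP := lact_action HX; have ractP := ract_action HX.
have lfree := lact_free HX; have rfree := ract_free HX.
have comm := actions_commute HX; have inv := exhaustion_invariant HX.
pose W := supp_seq B; pose WV := [seq g^-1%g | g <- W].
pose V i := real_dim (kernel (compressed_op W (real_coef B) lactP ractP rfree (Hr i))).
pose D := real_dim (kernel (conv_op W (real_coef B) (mul_left_action G))).
pose out (W' : seq G) i :=
  #|[pred a | `[< exists2 g, g \in W' & ~ Xs i (lact g (r i a)) >]]|.
pose N i := norbits ract (Xs i).
have dimE i : vn_dim_orbits ract (r i) (l2ker (compression B lact (A := Xs i))) = V i / 2.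
  exact: vn_dim_compression (inv i) (Hr i).
rewrite vn_dim_conv; under eq_fun do rewrite dimE.
have upper i : V i <= (N i)%:R * D + (out W i * (d * 2))%:R.
  have le1 := real_dim_compressed_le W (real_coef B) lactP lfree ractP rfree comm
    (inv i) (Hr i).
  apply: (le_trans le1).
  rewrite lerD2l ler_nat; apply: card_first_coordinate => p.
  by move/exitsP.
have lower i : (N i)%:R * D <= V i + (out WV i * (d * 2))%:R.
  have le1 := real_dim_compressed_ge W (real_coef B) lactP lfree ractP rfree comm
    (inv i) (Hr i).
  apply: (le_trans le1).
  rewrite lerD2l ler_nat; apply: card_first_coordinate => p.
  by move/exits_invP => [g gW nA]; exists g^-1%g => //; exact: map_f.
have ratio W' : (fun i => d%:R * ((out W' i)%:R / (N i)%:R)) @ \oo --> (0 : R).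
  rewrite -(mulr0 (d%:R : R)); apply: cvgM; first exact: cvg_cst.
  exact: (exit_ratio HX Hr W').
apply: (@squeeze_cvgr _ _ _ _
  (fun i => D / 2 - d%:R * ((out WV i)%:R / (N i)%:R))
  (fun i => D / 2 + d%:R * ((out W i)%:R / (N i)%:R))).
- have gt0 := norbits_gt0 HX Hr.
  near=> i.
  have N0 : 0 < (N i)%:R :> R by rewrite ltr0n; near: i.
  have eqN x : d%:R * (x / (N i)%:R) * (N i)%:R = d%:R * x :> R.
    by field; rewrite gt_eqF.
  have := upper i; have := lower i; rewrite !natrM => lo up.
  rewrite ler_pdivlMr // ler_pdivrMr // mulrBl mulrDl !eqN.
  by apply/andP; split; lra.
- rewrite -[X in _ --> X]subr0; apply: cvgB; [exact: cvg_cst|exact: ratio].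
- rewrite -[X in _ --> X]addr0; apply: cvgD; [exact: cvg_cst|exact: ratio].
Unshelve. all: by end_near.
Qed.
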